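(* Let $b,N\in\mathbb{Z}$ with $b\ge 1$, $N\ge 3$ and $N\equiv 3\pmod 4$. Define $f_{N,b}(x):=x^N-x-(N-1)N^b$ and $\delta:=1-N^{(b+1)N-b}$. Suppose that $f_{N,b}(x)$ is irreducible over $\mathbb{Q}$. Then $f_{N,b}(x)$ is monogenic if and only if $\delta$ is squarefree. Furthermore, no two distinct such monogenic trinomials $f_{N,b}(x)$ (for the same $N$) generate the same degree-$N$ extension of $\mathbb{Q}$, and the ideal class group of the imaginary quadratic field $\mathbb{Q}(\sqrt{\delta})$ contains an element of order $(b+1)N-b$.
   Context: A monic polynomial $f(x)\in\mathbb{Z}[x]$ of degree $N\ge 2$ is called monogenic if $f(x)$ is irreducible over $\mathbb{Q}$ and $\{1,\theta,\ldots,\theta^{N-1}\}$ is a basis for the ring of integers of $\mathbb{Q}(\theta)$, where $f(\theta)=0$. ''Generate the same extension'' means that $\mathbb{Q}(\theta_1)=\mathbb{Q}(\theta_2)$ for roots $\theta_1,\theta_2$ of the two polynomials. *)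

(* Defs.v *)
(* Number fields are subfields of algC, encoded as sets. *)
From HB Require Import structures.
From mathcomp Require Import all_boot all_order all_algebra all_field.
From mathcomp Require Import boolp classical_sets.

Set Implicit Arguments.
Unset Strict Implicit.
Unset Printing Implicit Defensive.

Import Order.TTheory GRing.Theory Num.Theory.
Local Open Scope ring_scope.
Local Open Scope classical_set_scope.

Definition squarefreez (m : int) : Prop :=
  forall d : int, (d ^+ 2 %| m)%Z -> d \is a GRing.unit.

(* The field Q(theta), as a subset of algC. *)
Definition Qadjoin (theta : algC) : set algC :=
  [set x | exists p q : {poly rat},
     (map_poly ratr q).[theta] != 0 /\
     x = (map_poly ratr p).[theta] / (map_poly ratr q).[theta]].

Definition ring_of_integers (K : set algC) : set algC :=
  [set x | K x /\ x \in Aint].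

Definition Zbasis (n : nat) (v : 'I_n -> algC) (M : set algC) : Prop :=
  (forall x, M x <-> exists c : 'I_n -> int, x = \sum_(i < n) v i *~ c i) /\
  (forall c : 'I_n -> int, \sum_(i < n) v i *~ c i = 0 -> forall i, c i = 0).

Definition monogenic (f : {poly int}) : Prop :=
  [/\ f \is monic,
      (2 <= (size f).-1)%N,
      irreducible_poly (map_poly intr f : {poly rat}) &
      forall theta : algC, root (map_poly intr f) theta ->
        Zbasis (fun i : 'I_(size f).-1 => theta ^+ i)
               (ring_of_integers (Qadjoin theta))].

Definition generate_same_extension (f g : {poly int}) : Prop :=
  exists theta1 theta2 : algC,
    [/\ root (map_poly intr f) theta1, root (map_poly intr g) theta2 &
        Qadjoin theta1 = Qadjoin theta2].

Definition fractional_ideal (K I : set algC) : Prop :=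
  [/\ I `<=` K,
      forall x y, I x -> I y -> I (x - y),
      forall a x, ring_of_integers K a -> I x -> I (a * x),
      exists2 x, I x & x != 0 &
      exists d, [/\ ring_of_integers K d, d != 0 &
                    forall x, I x -> ring_of_integers K (d * x)]].

Definition idealM (I J : set algC) : set algC :=
  [set x | exists (n : nat) (u v : 'I_n -> algC),
     [/\ forall i, I (u i), forall i, J (v i) & x = \sum_(i < n) u i * v i]].

(* The class of I modulo multiplication by nonzero principal ideals. *)
Definition ideal_class (K I : set algC) : set (set algC) :=
  [set J | exists a, [/\ K a, a != 0 & J = [set a * x | x in I]]].

Definition class_group (K : set algC) : set (set (set algC)) :=
  [set ideal_class K I | I in fractional_ideal K].

Definition class_group1 (K : set algC) : set (set algC) :=
  ideal_class K (ring_of_integers K).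

(* Product of cosets; see ideal_classM below. *)
Definition class_groupM (C D : set (set algC)) : set (set algC) :=
  [set idealM I J | I in C & J in D].

Definition class_groupX (K : set algC) (C : set (set algC)) (n : nat) :=
  iter n (class_groupM C) (class_group1 K).

Definition class_group_order (K : set algC) (C : set (set algC)) (n : nat) :=
  [/\ (0 < n)%N,
      class_groupX K C n = class_group1 K &
      forall k, (0 < k < n)%N -> class_groupX K C k <> class_group1 K].

Lemma ideal_classM (theta : algC) (I J : set algC) (K := Qadjoin theta) :
  class_groupM (ideal_class K I) (ideal_class K J) = ideal_class K (idealM I J).
Proof.
have lift c (A : set algC) n (w : 'I_n -> algC) :
    (forall i, [set c * x | x in A] (w i)) ->
    exists w' : 'I_n -> algC, forall i, A (w' i) /\ c * w' i = w i.
  move=> wA; have /choice[w' w'P] i : exists x, A x /\ c * x = w i.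
    by have [x Ax <-] := wA i; exists x.
  by exists w'.
have K1 : K 1.
  by exists 1, 1; rewrite rmorph1 hornerC oner_eq0 divr1.
have KM a b : K a -> K b -> K (a * b).
  move=> [p [q [q0 ->]]] [p' [q' [q'0 ->]]]; exists (p * p'), (q * q').
  by rewrite !rmorphM !hornerM mulf_neq0 // mulf_div.
apply/seteqP; split => [_ [_ [a [Ka a0 ->]] [_ [b [Kb b0 ->]] <-]]|].
  exists (a * b); split; rewrite ?mulf_neq0 //; first exact: KM.
  apply/seteqP; split => [_ [n [u [v [uI vJ ->]]]]|].
    have [u' u'P] := lift _ _ _ _ uI; have [v' v'P] := lift _ _ _ _ vJ.
    exists (\sum_i u' i * v' i).
      by exists n, u', v'; split => // i; [case: (u'P i)|case: (v'P i)].
    rewrite mulr_sumr; apply: eq_bigr => i _.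
    by case: (u'P i) => _ <-; case: (v'P i) => _ <-; rewrite mulrACA.
  move=> _ [_ [n [u [v [uI vJ ->]]]] <-].
  exists n, (fun i => a * u i), (fun i => b * v i).
  split=> [i|i|]; [by exists (u i)|by exists (v i)|].
  by rewrite mulr_sumr; apply: eq_bigr => i _; rewrite mulrACA.
move=> _ [a [Ka a0 ->]].
exists [set a * x | x in I]; first by exists a.
exists J.
  exists 1; split; rewrite ?oner_eq0 //.
  apply/seteqP; split=> [x Jx|_ [x Jx <-]]; last by rewrite mul1r.
  by exists x; rewrite ?mul1r.
apply/seteqP; split => [_ [n [u [v [uI vJ ->]]]]|].
  have [u' u'P] := lift _ _ _ _ uI.
  exists (\sum_i u' i * v i).
    by exists n, u', v; split => // i; case: (u'P i).
  rewrite mulr_sumr; apply: eq_bigr => i _.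
  by case: (u'P i) => _ <-; rewrite mulrA.
move=> _ [_ [n [u [v [uI vJ ->]]]] <-].
exists n, (fun i => a * u i), v; split=> // [i|]; first by exists (u i).
by rewrite mulr_sumr; apply: eq_bigr => i _; rewrite mulrA.
Qed.

Definition trinomial (N b : nat) : {poly int} :=
  'X^N - 'X - ((N%:Z - 1) * N%:Z ^+ b)%:P.

(* For N >= 1 the subtraction on nat is not truncated. *)
Definition delta (N b : nat) : int := 1 - N%:Z ^+ ((b + 1) * N - b).

(* Main.v *)
(* Write R = Z[theta] for a root theta of f = x^N - x - (N-1)N^b, e = N^(b+1) and
   n = (b+1)N - b. Then theta f'(theta) = (N-1)(theta + e), f(-e) = N^b delta and
   f'(-e) = -delta, so f = (x+e)^2 k - delta (x+e) + N^b delta.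

   If q^2 | delta, then (theta+e) k(theta) / q has its square in R, hence is an algebraic
   integer outside R. Conversely let x be an algebraic integer with q x in R. Over F_q,
   f | T^k implies f | f'T, so f'(theta) x lies in R; this gives x in R unless q divides
   delta. If q divides delta exactly once, the ideal (q, A) is locally generated by A,
   for A = theta + e, or A = theta^m - 1 when N - 1 = q m, and again x lies in R.

   For maximal R a prime q divides delta exactly when R/qR is not reduced. The squarefree
   number delta is therefore determined by the field.

   In Q(sqrt delta) put alpha = 1 + sqrt delta, of norm N^n. The ideals (N^k, alpha)
   multiply like powers for k <= n, and (N^n, alpha) = (alpha). If the class of
   (N, alpha) had order less than n, then alpha = g^p for an integer g = x + s, with p
   an odd prime and s^2 = D a negative integer. Comparing real parts gives x = 1, and
   q-adic valuations of the terms 'C(p, 2k) D^k leave only D = -2, -6. Expansions in a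
   2-adic and a 3-adic variable then leave only 3^5 = 1 + 2 * 11^2 (N = 3, b = 1), where f
   has the root 2. *)

Require Import Defs.
From HB Require Import structures.
From mathcomp Require Import all_boot all_order all_algebra all_field.
From mathcomp Require Import boolp classical_sets.
From mathcomp Require Import zify ring.
Set Implicit Arguments.
Unset Strict Implicit.
Unset Printing Implicit Defensive.
Import Order.TTheory GRing.Theory Num.Theory.
Local Open Scope ring_scope.

(** * Reduction modulo a prime *)

(* Any common factor of [f] and [t] can be split off [f]; the cofactor again
   divides [t ^+ k] and has smaller degree. *)
Lemma dvdp_deriv_mul (F : fieldType) (f t : {poly F}) k :
  f %| t ^+ k -> f %| f^`() * t.
Proof.
elim: {f}(size f).+1 {-2}f (ltnSn (size f)) => // n IHn f lefn ft.
have [->|f0] := eqVneq f 0; first by rewrite deriv0 mul0r dvdp0.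
have [cft|ncft] := boolP (coprimep f t).
  have : f %| 1 by rewrite -(Gauss_dvdpl _ (coprimep_expr k cft)) mul1r.
  by move=> f1; apply: dvdp_trans f1 (dvd1p _).
set g := gcdp f t in ncft *.
have gf : g %| f by apply: dvdp_gcdl.
have gt : g %| t by apply: dvdp_gcdr.
have g0 : g != 0 by apply: contraNneq f0 => g0; rewrite -dvd0p -g0.
have fE : f = (f %/ g) * g by rewrite divpK.
set h := f %/ g in fE.
have h0 : h != 0 by apply: contraNneq f0 => h0; rewrite fE h0 mul0r.
have hf : h %| f by rewrite fE dvdp_mulr.
have g1 : (1 < size g)%N.
  by rewrite ltn_neqAle eq_sym size_poly_gt0 g0 andbT.
have hlt : (size h < n)%N.
  move: lefn g1 (size_mul h0 g0); rewrite -fE.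
  move: h0; rewrite -size_poly_gt0.
  by move: (size f) (size h) (size g) => a b c; lia.
have hIH := IHn _ hlt (dvdp_trans hf ft).
rewrite fE derivM mulrDl dvdp_add //.
  by rewrite -mulrA (mulrC g) mulrA dvdp_mul.
by rewrite -mulrA dvdp_mul // dvdp_mull.
Qed.

(** A separable [f] is coprime to [f'], so [f'] cancels from the previous divisibility. *)
Lemma coprimep_deriv_dvdX (F : fieldType) (f t : {poly F}) k :
  coprimep f f^`() -> f %| t ^+ k -> f %| t.
Proof. by move=> cff /dvdp_deriv_mul; rewrite Gauss_dvdpr. Qed.

Local Notation redp q := (map_poly (intr : int -> 'F_q)).

Lemma redp_eq0 (q : nat) (P : {poly int}) : prime q ->
  redp q P = 0 -> exists U, P = q%:Z *: U.
Proof.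
move=> q_pr P0; exists (map_poly (fun a => (a %/ q)%Z) P).
apply/polyP=> i; rewrite coefZ coef_map_id0 ?div0z // mulrC divzK //.
by rewrite (dvdz_pcharf (pchar_Fp q_pr)) -coef_map P0 coef0.
Qed.

Lemma redpZ (q : nat) (P : {poly int}) : prime q -> redp q (q%:Z *: P) = 0.
Proof.
move=> q_pr; apply/polyP=> i; rewrite coef_map coefZ coef0; apply/eqP.
by rewrite -(dvdz_pcharf (pchar_Fp q_pr)) dvdz_mulr.
Qed.

Lemma redp_surj (q : nat) (T : {poly 'F_q}) : exists P, redp q P = T.
Proof.
exists (map_poly (fun a : 'F_q => (a : nat)%:Z) T).
by apply/polyP=> i; rewrite coef_map coef_map_id0 //= -pmulrn natr_Zp.
Qed.

(** Turns divisibility over ['F_q] into membership in the ideal [(q, f)] of Z[x], an identity that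
    can be evaluated at [theta]. *)
Lemma redp_dvdP (q : nat) (f P : {poly int}) : prime q ->
  redp q f %| redp q P <-> exists U W, P = q%:Z *: U + f * W.
Proof.
move=> q_pr; split=> [/dvdpP[W' PE]|[U [W ->]]]; last first.
  by rewrite rmorphD /= redpZ // add0r rmorphM dvdp_mulr.
have [W WE] := redp_surj W'.
have [|U UE] := @redp_eq0 q (P - f * W) q_pr.
  by rewrite rmorphB rmorphM /= WE PE mulrC subrr.
by exists U, W; rewrite -UE subrK.
Qed.

(** * The order Z[theta] *)

Definition evz (theta : algC) (P : {poly int}) : algC := (map_poly intr P).[theta].

HB.instance Definition _ theta :=
  GRing.RMorphism.copy (evz theta) (horner_eval theta \o map_poly intr).

Definition Zadjoin (theta : algC) : set algC := range (evz theta).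

Lemma evzX theta : evz theta 'X = theta.
Proof. by rewrite /evz map_polyX hornerX. Qed.

Lemma evzC theta (c : int) : evz theta c%:P = c%:~R.
Proof. by rewrite /evz map_polyC hornerC. Qed.

Lemma evzZ theta (c : int) P : evz theta (c *: P) = c%:~R * evz theta P.
Proof. by rewrite -mul_polyC rmorphM /= evzC. Qed.

Lemma evz_Aint theta P : theta \in Aint -> evz theta P \in Aint.
Proof.
move=> th; rewrite /evz horner_coef rpred_sum // => i _.
by rewrite rpredM ?rpredX // coef_map Aint_int.
Qed.

Lemma Aint_int_poly x : x \in Aint ->
  exists2 h : {poly int}, h \is monic & root (map_poly intr h) x.
Proof.
move=> xA; have /floorpP[h hE] : minCpoly x \is a polyOver Num.int by [].
exists h; last by rewrite -hE root_minCpoly.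
have := minCpoly_monic x; rewrite hE !monicE lead_coef_map_inj //; last exact: intr_inj.
by rewrite -[X in _ == X -> _](rmorph1 intr) eqr_int.
Qed.

Lemma int_poly_Aint (h : {poly int}) x :
  h \is monic -> root (map_poly intr h) x -> x \in Aint.
Proof.
move=> hm hx; apply: root_monic_Aint hx _ _; first exact: monic_map.
by apply/polyOverP=> i; rewrite coef_map /= intr_int.
Qed.

Lemma map_ratr_intr (P : {poly int}) :
  map_poly ratr (map_poly intr P : {poly rat}) = map_poly intr P :> {poly algC}.
Proof.
by rewrite -map_poly_comp; apply: eq_map_poly => b; rewrite /= rmorph_int.
Qed.

Section Zadjoin.
Variables (f : {poly int}) (theta : algC).
Hypotheses (f_monic : f \is monic)
  (f_irr : irreducible_poly (map_poly intr f : {poly rat}))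
  (f_theta : root (map_poly intr f) theta).

Let theta_Aint : theta \in Aint. Proof. exact: int_poly_Aint f_theta. Qed.

Lemma evz_f : evz theta f = 0. Proof. exact/rootP. Qed.

Lemma ratr_root_dvdp (p : {poly rat}) :
  root (map_poly ratr p) theta = (map_poly intr f %| p).
Proof.
apply/idP/idP => [p_root|/dvdpP[u ->]]; last first.
  by rewrite rmorphM rootM /= map_ratr_intr f_theta orbT.
apply: contraLR p_root; rewrite -irreducible_poly_coprime //.
rewrite -(coprimep_map (ratr : {rmorphism rat -> algC})) map_ratr_intr.
by move/coprimep_root => H; rewrite H.
Qed.

(** By irreducibility [f] divides [P] over the rationals; the quotient is integral because [f] is
    monic. *)
Lemma evz_eq0 P : evz theta P = 0 -> exists Q, P = f * Q.
Proof.
move=> P0; have : map_poly intr f %| map_poly (intr : int -> rat) P.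
  by rewrite -ratr_root_dvdp map_ratr_intr; apply/rootP.
rewrite dvdp_rat_int => /(Pdiv.IdomainMonic.dvdpP f_monic)[Q ->].
by exists Q; rewrite mulrC.
Qed.

(** A denominator that does not vanish at [theta] is coprime to [f], and its Bezout cofactor
    evaluates to its inverse. *)
Lemma Qadjoin_poly z : Qadjoin theta z <->
  exists P : {poly rat}, z = (map_poly ratr P).[theta].
Proof.
split=> [[p [q [q0 ->]]]|[P ->]]; last first.
  by exists P, 1; rewrite rmorph1 hornerC oner_eq0 divr1.
have : coprimep (map_poly intr f) q.
  by rewrite irreducible_poly_coprime // -ratr_root_dvdp /root.
case/Bezout_eq1_coprimepP => -[u v] /= uv.
exists (p * v); rewrite rmorphM hornerM; congr (_ * _).
apply: (mulIf q0); rewrite mulVf // -hornerM -rmorphM /=.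
have -> : v * q = 1 - u * map_poly intr f by rewrite -uv addrC addKr.
rewrite rmorphB rmorphM rmorph1 /= map_ratr_intr hornerD hornerN hornerM hornerC.
by rewrite (rootP f_theta) mulr0 subr0.
Qed.

Lemma Qadjoin_scale z : Qadjoin theta z ->
  exists2 D : int, D != 0 & Zadjoin theta (D%:~R * z).
Proof.
case/Qadjoin_poly => P ->; have [Q [D D0 ->]] := rat_poly_scale P.
exists D => //; exists Q => //.
rewrite map_polyZ hornerZ map_ratr_intr fmorphV /= ratr_int mulVKf //.
by rewrite intr_eq0.
Qed.

Lemma Zadjoin_Qadjoin z : Zadjoin theta z -> Qadjoin theta z.
Proof.
by case=> P _ <-; apply/Qadjoin_poly; exists (map_poly intr P); rewrite map_ratr_intr.
Qed.

Lemma Zadjoin_O z : Zadjoin theta z -> ring_of_integers (Qadjoin theta) z.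
Proof.
move=> Zz; split; first exact: Zadjoin_Qadjoin.
by case: Zz => P _ <-; apply: evz_Aint.
Qed.

(* Clear denominators in an integral equation for [x] by a power of [A]. *)
Lemma Aint_mul_expr (x : algC) (A T : {poly int}) :
  x \in Aint -> evz theta A * x = evz theta T ->
  exists k S Q, T ^+ k = A * S + f * Q.
Proof.
case/Aint_int_poly => h hm hx Ax.
have hn : (size h).-1.+1 = size h.
  by rewrite prednK // size_poly_gt0 monic_neq0.
set n := (size h).-1 in hn.
(* [S] gathers the lower terms of [A ^ n h(x) = 0] after [A x] is replaced by [T]; one factor [A] is
   taken out of [A ^ (n - i)]. *)
pose S := \sum_(i < n) h`_i *: (A ^+ (n - i).-1 * T ^+ i).
have [|Q QE] := @evz_eq0 (T ^+ n + A * S).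
  rewrite rmorphD rmorphM rmorphXn /= /S rmorph_sum /= -Ax mulr_sumr.
  move/rootP: hx; rewrite horner_coef size_map_inj_poly //; last exact: intr_inj.
  rewrite -hn big_ord_recr /= !coef_map /=.
  have -> : h`_n = 1 by have /monicP := hm; rewrite lead_coefE.
  rewrite mul1r => /(congr1 (fun u => evz theta A ^+ n * u)).
  rewrite mulr0 mulrDr -exprMn addrC => E; rewrite -[RHS]E; congr (_ + _).
  rewrite mulr_sumr; apply: eq_bigr => i _.
  rewrite evzZ rmorphM !rmorphXn /= -Ax coef_map /=.
  have -> : evz theta A ^+ n = evz theta A * evz theta A ^+ (n - i).-1 * evz theta A ^+ i.
    by rewrite -exprS prednK ?subn_gt0 // -exprD subnK // ltnW.
  by rewrite exprMn; ring.
by exists n, (- S), Q; rewrite -QE mulrN addrC addrK.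
Qed.

Variable q : nat.
Hypothesis q_pr : prime q.

Let q0 : q%:~R != 0 :> algC.
Proof. by rewrite intr_eq0; case: (q) q_pr. Qed.

(** Here [x = T / q]. Evaluating [f' T = q U + f W] at [theta] and cancelling [q] gives
    [f' x = U]. *)
Lemma Zadjoin_deriv_mul x T k : q%:~R * x = evz theta T ->
  redp q f %| redp q T ^+ k -> Zadjoin theta (evz theta f^`() * x).
Proof.
move=> TE /dvdp_deriv_mul; rewrite deriv_map -rmorphM => /(redp_dvdP _ _ q_pr)[U [W E]].
exists U => //; have := congr1 (evz theta) E.
rewrite rmorphM rmorphD /= evzZ rmorphM /= evz_f mul0r addr0 -TE mulrCA.
by move/(mulfI q0) => ->.
Qed.

(** An integral equation for [x = T / q], cleared by a power of [q], puts some [T ^ k] in the ideal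
    [(q, f)]. *)
Lemma Aint_deriv_mul x : x \in Aint -> Zadjoin theta (q%:~R * x) ->
  Zadjoin theta (evz theta f^`() * x).
Proof.
move=> xA [T _ TE].
have [|k [S [Q E]]] := @Aint_mul_expr x q%:Z%:P T xA; first by rewrite evzC.
apply: (@Zadjoin_deriv_mul _ T k) => //.
by rewrite -rmorphXn; apply/redp_dvdP => //; exists S, Q; rewrite E mul_polyC.
Qed.

(* A local criterion for integral closedness: modulo the ideal (q, A) the
   number [q] is an associate of [A] times [w], hence (q, A) is invertible. *)
Lemma Zadjoin_local_closed (A w v P1 P2 P3 : {poly int}) x j :
  coprimep (redp q A) (redp q A)^`() -> redp q A %| redp q f ->
  q%:~R * evz theta v = evz theta (A * w) ->
  evz theta (P1 * v + P2 * A + q%:Z *: P3) = 1 ->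
  x \in Aint -> Zadjoin theta (q%:~R * x) ->
  Zadjoin theta (evz theta A ^+ j * x) -> Zadjoin theta x.
Proof.
(* Descent on [j]: for the integral element [y = A ^ j x], if [A y] is in R then so is [y]. *)
move=> sepA Af qv v1; elim: j x => [|j IHj] x xA qx; first by rewrite expr0 mul1r.
rewrite exprS -mulrA => AAx; apply: IHj => //.
have [T _ TE] := qx.
set y := _ * x in AAx *; have yA : y \in Aint.
  by rewrite /y rpredM ?rpredX // evz_Aint.
have [T1 _ T1E] := AAx.
have [U1 U1E] : exists U, q%:~R * y = evz theta U.
  by exists (A ^+ j * T); rewrite rmorphM rmorphXn /= TE /y mulrCA.
have [k [S [Q E]]] := Aint_mul_expr yA (esym T1E).
(* Modulo [q], [A] divides [f], hence [T1 ^ k], and, being separable, [T1] itself. *)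
have : redp q A %| redp q T1 ^+ k.
  rewrite -rmorphXn E rmorphD !rmorphM /= dvdp_add ?dvdp_mulr //.
move/(coprimep_deriv_dvdX sepA)/(redp_dvdP _ _ q_pr) => [r1 [r2 rE]].
(* after subtracting [r2], [A y] becomes divisible by [q] *)
pose z := y - evz theta r2.
have Az : evz theta A * z = q%:~R * evz theta r1.
  by rewrite /z mulrBr -T1E rE rmorphD rmorphM /= evzZ addrK.
have vz : evz theta v * z = evz theta w * evz theta r1.
  by apply: (mulfI q0); rewrite mulrA qv rmorphM /= mulrAC Az; ring.
(* Multiply [1 = P1 v + P2 A + q P3] by [z], using [v z = w r1], [A z = q r1] and
   [q z = U1 - q r2]. *)
exists (P1 * w * r1 + P2 * (q%:Z *: r1) + P3 * (U1 - q%:Z *: r2) + r2) => //.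
rewrite -[y](subrK (evz theta r2)) -/z -[z]mul1r -v1 rmorphD; congr (_ + _).
rewrite !(rmorphD, rmorphM, rmorphN) /= !evzZ -U1E -Az -mulrBr -/z.
by rewrite -[evz theta P1 * _ * _]mulrA -vz; ring.
Qed.

Lemma Zadjoin_coprime (a : int) x : coprimez q a ->
  Zadjoin theta (q%:~R * x) -> Zadjoin theta (a%:~R * x) -> Zadjoin theta x.
Proof.
case/coprimezP => -[u v] /= uv [T _ TE] [T' _ TE'].
exists (u *: T + v *: T') => //; rewrite rmorphD /= !evzZ TE TE' !mulrA -!rmorphM.
by rewrite -mulrDl -rmorphD /= uv mul1r.
Qed.

End Zadjoin.

Lemma ZadjoinB theta x y :
  Zadjoin theta x -> Zadjoin theta y -> Zadjoin theta (x - y).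
Proof. by move=> [P _ <-] [Q _ <-]; exists (P - Q); rewrite // rmorphB. Qed.

Lemma ZadjoinM theta P x : Zadjoin theta x -> Zadjoin theta (evz theta P * x).
Proof. by move=> [Q _ <-]; exists (P * Q); rewrite // rmorphM. Qed.

(** * The trinomial and its roots *)

(** The middle binomial coefficients are divisible by [q], and every middle term contains a factor
    [a]. *)
Lemma exp1D_prime (R : comNzRingType) (q : nat) (a : R) : prime q ->
  exists B, (1 + a) ^+ q = 1 + (a ^+ q + a * B *+ q).
Proof.
case: q => // p q_pr; exists (\sum_(i < p) a ^+ i *+ ('C(p.+1, i.+1) %/ p.+1)).
rewrite exprDn big_ord_recl big_ord_recr /= !expr1n binn bin0 !mulr1n !mul1r.
rewrite [X in _ + X]addrC; congr (_ + (_ + _)).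
rewrite mulr_sumr -sumrMnl; apply: eq_bigr => i _.
rewrite expr1n mul1r exprS mulrnAr -mulrnA divnK //.
by rewrite prime_dvd_bin //= ltnS ltn_ord.
Qed.

Section Trinomial.
Variables (N b : nat).
Hypotheses (N_gt0 : (0 < N)%N) (N_odd : odd N).

Local Notation e := (N%:Z ^+ b.+1).
Local Notation f := (trinomial N b).
Local Notation d := (delta N b).

Lemma deltaE : d = 1 - N%:Z ^+ ((b + 1) * N - b).
Proof. by []. Qed.

Lemma delta_exp_gt0 : (0 < (b + 1) * N - b)%N.
Proof. by clear N_odd; nia. Qed.

Lemma dvdz_subr1_delta : (N%:Z - 1 %| d)%Z.
Proof. by rewrite deltaE -opprB subrX1 -mulrN dvdz_mulr. Qed.

Lemma coprime_delta : coprimez N d.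
Proof.
apply/coprimezP; exists (N%:Z ^+ ((b + 1) * N - b).-1, 1) => /=.
by rewrite -exprSr prednK ?delta_exp_gt0 // deltaE mul1r addrC subrK.
Qed.

Lemma size_trinomial : (1 < N)%N -> size f = N.+1.
Proof.
move=> N1; rewrite /trinomial -addrA size_polyDl size_polyXn //.
rewrite -opprD size_polyN size_polyDl size_polyX // (leq_ltn_trans (size_polyC_leq1 _)) //.
Qed.

Lemma trinomial_monic : (1 < N)%N -> f \is monic.
Proof.
move=> N1; rewrite monicE lead_coefE size_trinomial //= !coefB coefXn eqxx.
by rewrite coefX coefC gtn_eqF // gtn_eqF ?(ltnW N1) // !subr0.
Qed.

Lemma deriv_trinomial : f^`() = N%:Z *: 'X^(N.-1) - 1.
Proof.
by rewrite /trinomial !derivB derivXn derivX derivC subr0 -[N%:Z]natz scaler_nat.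
Qed.

Lemma trinomial_deriv_eq :
  'X * f^`() = N%:Z *: f + (N%:Z - 1) *: ('X + e%:P).
Proof.
rewrite deriv_trinomial /trinomial -!mul_polyC.
have -> : ('X^N : {poly int}) = 'X * 'X^(N.-1) by rewrite -exprS prednK.
by rewrite !rmorphM !rmorphB !rmorphXn /= exprS; ring.
Qed.

(** As [N] is odd, the value is [- e ^ N + e - (N - 1) N ^ b], where [e - (N - 1) N ^ b = N ^ b]. *)
Lemma trinomial_at : f.[- e] = N%:Z ^+ b * d.
Proof.
rewrite /trinomial !hornerE exprNn -signr_odd N_odd expr1.
rewrite deltaE mulrBr mulr1 -exprD subnKC -?exprM; last by nia.
have -> : (b.+1 * N)%N = ((b + 1) * N)%N by rewrite addn1.
by rewrite exprS; ring.
Qed.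

Lemma deriv_trinomial_at : f^`().[- e] = - d.
Proof.
rewrite deriv_trinomial !hornerE exprNn -signr_odd.
have -> : odd N.-1 = false by case: (N) N_odd => //= k /negbTE.
rewrite expr0 mul1r deltaE -exprM -exprS opprB; congr (_ ^+ _ - _).
by nia.
Qed.

Lemma trinomial_factor : exists h, f = ('X + e%:P) * h + (N%:Z ^+ b * d)%:P.
Proof.
have : root (f - (N%:Z ^+ b * d)%:P) (- e).
  by rewrite /root hornerD hornerN hornerC trinomial_at subrr.
case/factor_theorem => h hE; exists h.
by rewrite -[LHS](subrK (N%:Z ^+ b * d)%:P) hE polyCN opprK mulrC.
Qed.

(** Taylor expansion at [-e]: value and derivative there give the last two terms, and [k] is what
    remains after dividing twice by ['X + e]. *)
Lemma trinomial_factor2 : (1 < N)%N -> exists k, [/\ k \is monic, size k = N.-1 &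
  f = ('X + e%:P) ^+ 2 * k - d *: ('X + e%:P) + (N%:Z ^+ b * d)%:P].
Proof.
move=> N1; have [h hE] := trinomial_factor.
have he : h.[- e] = - d.
  rewrite -deriv_trinomial_at hE derivD derivM derivC addr0 derivD derivX derivC.
  by rewrite addr0 mul1r !hornerE (subrr, addNr) ?mul0r ?addr0.
have : root (h + d%:P) (- e) by rewrite /root hornerD he hornerC addNr.
case/factor_theorem => k; rewrite polyCN opprK => kE.
have fE : f = ('X + e%:P) ^+ 2 * k - d *: ('X + e%:P) + (N%:Z ^+ b * d)%:P.
  rewrite hE -[h](addrK d%:P) kE -!mul_polyC; ring.
have mon2 : ('X + e%:P) ^+ 2 \is monic by rewrite monic_exp // monicXaddC.
have s2 : size (('X + e%:P) ^+ 2 : {poly int}) = 3%N.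
  by rewrite -[e%:P]opprK -polyCN size_exp_XsubC.
(* [r] has degree at most 1, so [f + r] and [f] share size and leading coefficient, from which those
   of [k] are read. *)
pose r := d *: ('X + e%:P) - (N%:Z ^+ b * d)%:P : {poly int}.
have kf : ('X + e%:P) ^+ 2 * k = f + r by rewrite {1}fE /r; ring.
have sr : (size r < size f)%N.
  rewrite size_trinomial // (@leq_ltn_trans 2) ?ltnS //.
  rewrite /r -polyCN; apply: (leq_trans (size_polyD _ _)); rewrite geq_max.
  rewrite (leq_trans (size_scale_leq _ _)) ?size_XaddC //.
  exact: leq_trans (size_polyC_leq1 _) _.
have k0 : k != 0.
  apply: contraTneq sr => k0; move/eqP: kf; rewrite k0 mulr0 eq_sym addr_eq0.
  by move/eqP->; rewrite size_polyN ltnn.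
exists k; split=> //.
  rewrite monicE -(lead_coef_monicM _ mon2) kf lead_coefDl //.
  by rewrite -monicE trinomial_monic.
have := size_monicM mon2 k0; rewrite kf size_polyDl // size_trinomial // s2.
by move: (size k) => sk; lia.
Qed.
End Trinomial.

(** The powers of [theta] are always a basis of Z[theta]: division by the monic [f] gives
    generation, and the kernel [(f)] of evaluation gives freeness by degrees. *)
Lemma Zbasis_Zadjoin (f : {poly int}) theta (M : set algC) :
  f \is monic -> irreducible_poly (map_poly intr f : {poly rat}) ->
  root (map_poly intr f) theta ->
  Zbasis (fun i : 'I_(size f).-1 => theta ^+ i) M <-> M = Zadjoin theta.
Proof.
move=> f_mon f_irr f_theta.
have sf : (size f).-1.+1 = size f by rewrite prednK // size_poly_gt0 monic_neq0.
have sum_evz (c : 'I_(size f).-1 -> int) :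
    \sum_(i < (size f).-1) theta ^+ i *~ c i =
    evz theta (\sum_(i < (size f).-1) c i *: 'X^i).
  rewrite rmorph_sum; apply: eq_bigr => i _ /=.
  by rewrite evzZ rmorphXn /= evzX mulrzl.
have coef_sum (c : 'I_(size f).-1 -> int) (j : 'I_(size f).-1) :
    (\sum_(i < (size f).-1) c i *: 'X^i)`_j = c j.
  rewrite coef_sum (bigD1 j) //= coefZ coefXn eqxx mulr1 big1 ?addr0 // => i ij.
  by rewrite coefZ coefXn eq_sym (inj_eq val_inj) (negPf ij) mulr0.
have size_sum (c : 'I_(size f).-1 -> int) :
    (size (\sum_(i < (size f).-1) c i *: 'X^i)%R < size f)%N.
  apply: (@leq_ltn_trans (size f).-1); last by rewrite sf.
  apply: (leq_trans (size_sum _ _ _)); apply/bigmax_leqP => i _.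
  by rewrite (leq_trans (size_scale_leq _ _)) // size_polyXn.
have ZadjE x : Zadjoin theta x <->
    exists c : 'I_(size f).-1 -> int, x = \sum_(i < (size f).-1) theta ^+ i *~ c i.
  split=> [[P _ <-]|[c ->]]; last by rewrite sum_evz; exists (\sum_(i < (size f).-1) c i *: 'X^i).
  exists (fun i => (Pdiv.Ring.rmodp P f)`_i); rewrite sum_evz.
  rewrite {1}(Pdiv.RingMonic.rdivp_eq f_mon P) rmorphD rmorphM /= (evz_f f_theta) mulr0 add0r.
  congr (evz _ _); apply/polyP=> j.
  have sm := Pdiv.Ring.ltn_rmodpN0 P (monic_neq0 f_mon).
  have [jf|jf] := ltnP j (size f).-1.
    by rewrite (coef_sum _ (Ordinal jf)).
  rewrite !nth_default // (leq_trans _ jf) // -ltnS sf //; exact: size_sum.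
have free (c : 'I_(size f).-1 -> int) :
    \sum_(i < (size f).-1) theta ^+ i *~ c i = 0 -> forall i, c i = 0.
  rewrite sum_evz => /(evz_eq0 f_mon f_irr f_theta) [Q QE] i.
  have [Q0|Q0] := eqVneq Q 0; first by rewrite -(coef_sum c i) QE Q0 mulr0 coef0.
  have := size_sum c; rewrite QE size_monicM //.
  move: Q0 sf; rewrite -size_poly_gt0.
  by move: (size f) (size Q) => u v; lia.
split=> [[ME _]|->]; last by split.
by apply/seteqP; split=> x; rewrite ?ME ?ZadjE // -?ME -?ZadjE.
Qed.

(** Otherwise [f] would divide [P] modulo [q], although the monic [P] keeps its degree, smaller than
    that of [f]. *)
Lemma monic_notin_qZ (f P : {poly int}) theta (q : nat) :
  f \is monic -> irreducible_poly (map_poly intr f : {poly rat}) ->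
  root (map_poly intr f) theta -> prime q -> P \is monic ->
  (size P < size f)%N -> ~ Zadjoin theta (evz theta P / q%:~R).
Proof.
move=> f_mon f_irr f_theta q_pr P_mon sPf [C _ CE].
have q0 : q%:~R != 0 :> algC by rewrite intr_eq0; case: (q) q_pr.
have [|Q QE] := @evz_eq0 f theta f_mon f_irr f_theta (P - q%:Z *: C).
  by rewrite rmorphB /= evzZ CE mulrC divfK // subrr.
have : redp q f %| redp q P.
  by apply/redp_dvdP => //; exists C, Q; rewrite -QE addrC subrK.
move/dvdp_leq; rewrite monic_neq0 ?monic_map // => /(_ isT).
have sz (R : {poly int}) : R \is monic -> size (redp q R) = size R.
  by move=> Rm; apply: size_map_poly_id0; rewrite (monicP Rm) oner_eq0.
by rewrite !sz // leqNgt sPf.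
Qed.

Lemma Aint_sqr x : x ^+ 2 \in Aint -> x \in Aint.
Proof.
case/Aint_int_poly => h hm hx.
apply: (@int_poly_Aint (h \Po 'X^2)).
  by rewrite monicE lead_coef_comp ?size_polyXn // lead_coefXn expr1n mulr1 -monicE.
by rewrite map_comp_poly map_polyXn /root horner_comp hornerXn.
Qed.

Lemma coprimez_prime (q : nat) (a : int) : prime q -> coprimez q a = ~~ (q %| a)%Z.
Proof. by move=> q_pr; rewrite coprimezE /= prime_coprime // dvdzE. Qed.

Lemma coprime_Xn_sub1_deriv (F : fieldType) m : m%:R != 0 :> F ->
  coprimep ('X^m - 1 : {poly F}) ('X^m - 1)^`().
Proof.
case: m => [|m] m0; first by rewrite eqxx in m0.
(* [1 = ('X / m) (m 'X^(m - 1)) - ('X^m - 1)], with [m] now written [m.+1]. *)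
apply/Bezout_eq1_coprimepP; exists (-1, m.+1%:R^-1 *: 'X).
rewrite derivB derivC subr0 derivXn /= -scalerAl mulrnAr -exprS -scaler_nat.
by rewrite scalerA mulVf // scale1r mulN1r opprB subrK.
Qed.

(** * Maximality of Z[theta], prime by prime *)

Section TrinomialField.
Variables (N b : nat) (theta : algC).
Hypotheses (N_gt1 : (1 < N)%N) (N_odd : odd N).
Local Notation e := (N%:Z ^+ b.+1).
Local Notation f := (trinomial N b).
Local Notation d := (delta N b).
Hypotheses (f_irr : irreducible_poly (map_poly intr f : {poly rat}))
  (f_theta : root (map_poly intr f) theta).

Let N_gt0 : (0 < N)%N. Proof. exact: ltnW. Qed.
Let f_mon : f \is monic. Proof. exact: trinomial_monic. Qed.
Let theta_Aint : theta \in Aint. Proof. exact: int_poly_Aint f_mon f_theta. Qed.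

(** Modulo [f], [('X + e) ^ 2 k] is [delta ('X + e - N ^ b)]; multiplying by [k] gives the square of
    [P = ('X + e) k]. Since [P] is monic of degree [N - 1], its value lies in q R for no prime
    [q]. *)
Lemma trinomial_sqr : exists P S, [/\ P \is monic, size P = N &
  evz theta P ^+ 2 = d%:~R * evz theta S].
Proof.
have [k [k_mon k_size fE]] := trinomial_factor2 b N_gt0 N_odd N_gt1.
exists (('X + e%:P) * k), (k * ('X + e%:P - (N%:Z ^+ b)%:P)).
have A_mon : ('X + e%:P : {poly int}) \is monic by exact: monicXaddC.
split; first by rewrite monicMl.
  by rewrite size_monicM ?monic_neq0 // size_XaddC k_size; lia.
rewrite -rmorphXn /= -evzZ; apply/eqP; rewrite -subr_eq0 -rmorphB /=; apply/eqP.
rewrite -[RHS](mulr0 (evz theta k)) -[0 in RHS](evz_f f_theta) -rmorphM /=.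
by congr (evz _ _); rewrite [in RHS]fE -!mul_polyC rmorphM /=; ring.
Qed.

Lemma maximal_not_sqr_dvd (q : nat) : prime q ->
  ring_of_integers (Qadjoin theta) = Zadjoin theta -> ~~ (q%:Z ^+ 2 %| d)%Z.
Proof.
move=> q_pr OE; apply/negP => /dvdzP[m dE].
have q0 : q%:~R != 0 :> algC by rewrite intr_eq0; case: (q) q_pr.
have [P [S [P_mon P_size PS]]] := trinomial_sqr.
apply: (monic_notin_qZ f_mon f_irr f_theta q_pr P_mon).
  by rewrite P_size size_trinomial.
rewrite -OE; split.
  apply/(Qadjoin_poly f_irr f_theta); exists (q%:~R^-1 *: map_poly intr P).
  by rewrite map_polyZ hornerZ map_ratr_intr fmorphV /= ratr_int mulrC.
apply: Aint_sqr; rewrite exprMn PS dE rmorphM rmorphXn /= exprVn mulrAC mulfK ?expf_neq0 //.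
by rewrite rpredM ?Aint_int // evz_Aint.
Qed.

(** The value of [P] is a nonzero nilpotent of R/qR, a property of R alone that can be compared
    between two trinomials. *)
Lemma ramified (q : nat) : prime q -> (q %| d)%Z ->
  exists y, [/\ Zadjoin theta y, Zadjoin theta (y ^+ 2 / q%:~R) &
                ~ Zadjoin theta (y / q%:~R)].
Proof.
move=> q_pr /dvdzP[m dE].
have q0 : q%:~R != 0 :> algC by rewrite intr_eq0; case: (q) q_pr.
have [P [S [P_mon P_size PS]]] := trinomial_sqr.
exists (evz theta P); split; first by exists P.
  by exists (m *: S); rewrite // evzZ PS dE rmorphM /= mulrAC mulfK.
by apply: (monic_notin_qZ f_mon f_irr f_theta) => //; rewrite P_size size_trinomial.
Qed.

Lemma deriv_mul_eta x : Zadjoin theta (evz theta f^`() * x) ->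
  Zadjoin theta ((N%:Z - 1)%:~R * (evz theta ('X + e%:P) * x)).
Proof.
move=> /(ZadjoinM 'X); rewrite mulrA -rmorphM /= trinomial_deriv_eq //.
by rewrite rmorphD /= !evzZ (evz_f f_theta) mulr0 add0r mulrA.
Qed.

(** If [q] divides [N], then [f'] is -1 modulo [q]. Otherwise multiplying [(N - 1) (theta + e) x] by
    the value of [h] gives [x] times [- (N - 1) N ^ b delta], an integer prime to [q]. *)
Lemma unramified_closed (q : nat) x : prime q -> ~~ (q %| d)%Z ->
  Zadjoin theta (q%:~R * x) -> Zadjoin theta (evz theta f^`() * x) ->
  Zadjoin theta x.
Proof.
move=> q_pr qd qx f'x; have [qN|qN] := boolP (q %| N)%N.
  have -> : x = evz theta ((N %/ q)%N%:Z *: 'X^(N.-1)) * (q%:~R * x) - evz theta f^`() * x.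
    have NE : N%:Z%:~R = (N %/ q)%N%:Z%:~R * q%:~R :> algC.
      by rewrite -rmorphM -PoszM divnK.
    by rewrite deriv_trinomial rmorphB rmorph1 /= !evzZ NE; ring.
  by apply: ZadjoinB => //; apply: ZadjoinM.
have [h hE] := trinomial_factor b N_gt0 N_odd.
apply: (@Zadjoin_coprime theta q ((N%:Z - 1) * (N%:Z ^+ b * d))) => //.
  have qN' : coprimez q N by rewrite coprimez_prime // dvdzE.
  rewrite !coprimezMr coprimezXr // coprimez_prime // andbC coprimez_prime // qd /=.
  by apply: contra qd => /dvdz_trans; apply; apply: dvdz_subr1_delta.
have /(ZadjoinM h) := deriv_mul_eta f'x.
have := evz_f f_theta; rewrite {1}hE rmorphD rmorphM /= evzC => /eqP.
rewrite addr_eq0 => /eqP hA.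
have -> : evz theta h * ((N%:Z - 1)%:~R * (evz theta ('X + e%:P) * x)) =
    - (((N%:Z - 1) * (N%:Z ^+ b * d))%:~R * x).
  by rewrite rmorphM /= -[X in _ = - (_ * X * x)]opprK -hA; ring.
by move=> H; rewrite -[_ * x]opprK -sub0r; apply: ZadjoinB H; exists 0; rewrite // rmorph0.
Qed.

(** If [y ^ 2] is in q R, then [f] divides [T ^ 2] modulo [q], so [f' y / q] is in R and
    [unramified_closed] applies. *)
Lemma unramified (q : nat) y : prime q -> ~~ (q %| d)%Z ->
  Zadjoin theta y -> Zadjoin theta (y ^+ 2 / q%:~R) -> Zadjoin theta (y / q%:~R).
Proof.
move=> q_pr qd [T _ <-] [U _ UE].
have q0 : q%:~R != 0 :> algC by rewrite intr_eq0; case: (q) q_pr.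
apply: (unramified_closed q_pr qd); first by rewrite mulrC divfK //; exists T.
apply: (@Zadjoin_deriv_mul f theta f_theta q q_pr _ T 2); first by rewrite mulrC divfK.
have [|Q QE] := @evz_eq0 f theta f_mon f_irr f_theta (T ^+ 2 - q%:Z *: U).
  by rewrite rmorphB rmorphXn /= evzZ UE mulrC divfK // subrr.
by rewrite -rmorphXn; apply/redp_dvdP => //; exists U, Q; rewrite -QE addrC subrK.
Qed.

(* At a prime dividing [delta] but not [N - 1], [q] is a unit times [theta + e]. *)
Lemma local_maximal_delta (q : nat) x : prime q -> (q %| d)%Z ->
  ~~ (q%:Z ^+ 2 %| d)%Z -> ~~ (q %| N%:Z - 1)%Z ->
  x \in Aint -> Zadjoin theta (q%:~R * x) -> Zadjoin theta x.
Proof.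
move=> q_pr /dvdzP[m dE] q2d qN1 xA qx.
have q0 : q%:Z != 0 by case: (q) q_pr.
have qN : coprimez q N.
  by have := coprime_delta b N_gt0; rewrite dE coprimezMr => /andP[_ +]; rewrite coprimez_sym.
have qm : coprimez q (N%:Z ^+ b * m).
  rewrite coprimezMr coprimezXr //= coprimez_prime //; apply: contra q2d.
  by case/dvdzP => m' mE; rewrite dE mE -mulrA dvdz_mull.
have [h hE] := trinomial_factor b N_gt0 N_odd.
have [[u v] /= uv] := coprimezP _ _ qm.
(* With [delta = m q], the relation [(theta + e) h = - N ^ b delta] exhibits [- N ^ b m], a unit
   modulo [q], as the cofactor of [q]. *)
apply: (@Zadjoin_local_closed f theta f_mon f_irr f_theta q q_pr ('X + e%:P) h
  (- (N%:Z ^+ b * m)%:P) (- v%:P) 0 u%:P x 1) => //.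
- rewrite rmorphD /= map_polyX map_polyC derivD derivX derivC addr0.
  exact: coprimep1.
- apply/redp_dvdP => //; exists (N%:Z ^+ b * m)%:P, h.
  by rewrite {1}hE dE -mul_polyC -rmorphM /= addrC; congr (_%:P + _); ring.
- have := evz_f f_theta; rewrite {1}hE rmorphD /= evzC => /eqP.
  rewrite addr_eq0 => /eqP ->; rewrite rmorphN /= evzC dE mulrN -rmorphM /=.
  by congr (- _%:~R); ring.
- rewrite mul0r addr0 mulrNN -mul_polyC -!rmorphM -rmorphD /= evzC -[RHS](rmorph1 intr).
  by rewrite -uv addrC; congr (_%:~R); ring.
(* Both [q] and [N - 1], which are coprime, multiply [(theta + e) x] into R. *)
rewrite expr1; apply: (@Zadjoin_coprime theta q (N%:Z - 1)).
- by rewrite coprimez_prime.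
- by rewrite mulrCA; apply: ZadjoinM.
- by apply: deriv_mul_eta; apply: (Aint_deriv_mul f_mon f_irr f_theta q_pr).
Qed.

(** With [N - 1 = q m], [f] is congruent to ['X ('X^m - 1) ^ q] modulo [q], and [A = 'X^m - 1] is
    separable because [q] does not divide [m]. *)
Lemma local_maximal_N1 (q : nat) x : prime q -> (q %| N%:Z - 1)%Z ->
  ~~ (q%:Z ^+ 2 %| N%:Z - 1)%Z ->
  x \in Aint -> Zadjoin theta (q%:~R * x) -> Zadjoin theta x.
Proof.
move=> q_pr /dvdzP[m' NE'] q2N xA qx.
have [m NE] : exists m : nat, N.-1 = (q * m)%N.
  have : (q %| N.-1)%N by rewrite -[(_ %| _)%N]/(q%:Z %| N.-1%:Z)%Z predn_int // NE' dvdz_mull.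
  by case/dvdnP => m ->; exists m; rewrite mulnC.
have NZ : N%:Z - 1 = q%:Z * m%:Z by rewrite -predn_int // NE.
have qm : ~~ (q %| m)%N.
  apply: contra q2N => /dvdnP[m1 mE]; rewrite NZ mE PoszM mulrCA -expr2.
  exact: dvdz_mull.
have qN : coprimez q N.
  apply/coprimezP; exists (- m%:Z, 1) => /=.
  by rewrite mul1r -[N%:Z](subrK 1) NZ; ring.
have qu : coprimez q (m%:Z * N%:Z ^+ b).
  by rewrite coprimezMr coprimezXr // andbT coprimez_prime.
have [[u v] /= uv] := coprimezP _ _ qu.
have [A AE] : exists A : {poly int}, A = 'X^m - 1 by exists ('X^m - 1).
have [B BE] := exp1D_prime A q_pr.
have XE : 'X^(N.-1) = 1 + (A ^+ q + q%:Z *: (A * B)).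
  by rewrite NE mulnC exprM -mul_polyC -[q%:Z]natz rmorph_nat mulr_natl -BE AE addrC subrK.
have fE : f = 'X * (A ^+ q + q%:Z *: (A * B)) - (q%:Z * (m%:Z * N%:Z ^+ b))%:P.
  rewrite /trinomial -{1}(prednK N_gt0) exprS XE mulrA -NZ; ring.
have q_gt0 := prime_gt0 q_pr.
have AqE : A ^+ q = A * A ^+ q.-1 by rewrite -exprS prednK.
pose w := 'X * A ^+ q.-1.
(* At [theta], [q (m N ^ b - 'X A B) = A w]; the bracket is a unit modulo [(q, A)] because [m N ^ b]
   is prime to [q]. *)
apply: (@Zadjoin_local_closed f theta f_mon f_irr f_theta q q_pr A w
  ((m%:Z * N%:Z ^+ b)%:P - 'X * A * B) v%:P (v%:P * 'X * B) u%:P x q) => //.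
- rewrite AE rmorphB rmorph1 /= map_polyXn; apply: coprime_Xn_sub1_deriv.
  by rewrite -(dvdn_pcharf (pchar_Fp q_pr)).
- apply/redp_dvdP => //; exists ('X * A * B - (m%:Z * N%:Z ^+ b)%:P), w.
  by rewrite {1}fE /w AqE -!mul_polyC rmorphM /=; ring.
- apply/eqP; rewrite -subr_eq0 -evzZ -rmorphB /=; apply/eqP.
  rewrite -[RHS]oppr0 -[0 in RHS](evz_f f_theta) -rmorphN /=; congr (evz _ _).
  by rewrite fE /w AqE -!mul_polyC !rmorphM /=; ring.
- rewrite -[RHS](rmorph1 (evz theta)); congr (evz _ _).
  rewrite -[RHS](rmorph1 polyC) -uv rmorphD !rmorphM /= -mul_polyC; ring.
(* Since [N = q m + 1], [f' = A ^ q + q (m 'X^(N - 1) + A B)], and both [f' x] and [q x] are in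
   R. *)
have -> : evz theta A ^+ q * x = evz theta f^`() * x -
    evz theta (m%:Z *: 'X^(N.-1) + A * B) * (q%:~R * x).
  have E : evz theta 'X^(N.-1) = 1 + (evz theta A ^+ q + q%:~R * evz theta (A * B)).
    by rewrite XE 2!rmorphD rmorph1 rmorphXn /= evzZ.
  have NR : N%:Z%:~R = q%:~R * m%:~R + 1 :> algC by rewrite -rmorphM -NZ rmorphB subrK.
  by rewrite deriv_trinomial rmorphB rmorph1 rmorphD /= !evzZ NR E; ring.
apply: ZadjoinB; last exact: ZadjoinM.
exact: (Aint_deriv_mul f_mon f_irr f_theta q_pr).
Qed.

Lemma squarefree_maximal : squarefreez d ->
  ring_of_integers (Qadjoin theta) = Zadjoin theta.
Proof.
move=> d_sqf; apply/seteqP; split=> [z [zK zA]|z]; last exact: (Zadjoin_O f_mon f_irr f_theta).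
have sqf (q : nat) : prime q -> ~~ (q%:Z ^+ 2 %| d)%Z.
  move=> q_pr; apply/negP => /d_sqf; rewrite qualifE /= => q1; case: (q) q_pr q1 => [|[|]]//.
have loc (q : nat) x : prime q -> x \in Aint -> Zadjoin theta (q%:~R * x) -> Zadjoin theta x.
  move=> q_pr xA qx; have [qd|qd] := boolP (q %| d)%Z; last first.
    by apply: (unramified_closed q_pr qd qx); apply: (Aint_deriv_mul f_mon f_irr f_theta q_pr).
  have [qN|qN] := boolP (q %| N%:Z - 1)%Z; last exact: (local_maximal_delta q_pr qd (sqf _ q_pr) qN xA qx).
  apply: (local_maximal_N1 q_pr qN _ xA qx); apply: contra (sqf q q_pr) => /dvdz_trans; apply.
  exact: dvdz_subr1_delta.
have [D D0 Dz] := Qadjoin_scale f_irr f_theta zK.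
have {D D0 Dz}[m m0 mz] : exists2 m : nat, (0 < m)%N & Zadjoin theta (m%:~R * z).
  exists `|D|%N; first by rewrite absz_gt0.
  case: Dz => P _ PE; exists ((-1) ^+ (D < 0)%R *: P) => //.
  by rewrite evzZ PE mulrA -rmorphM /= -abszEsign.
(* Strong induction on a denominator [m] of [z]: for a prime [q] dividing [m], [q z] has denominator
   [m / q], and [loc] then removes [q]. *)
elim: {m}m.+1 {-2}m (ltnSn m) z {zK} zA m0 mz => // n IHn m lmn z zA m0 mz.
have [m1|m1] := leqP m 1.
  have m1' : m = 1%N by lia.
  by move: mz; rewrite m1' mul1r.
have q_pr := pdiv_prime m1; set q := pdiv m in q_pr.
have mE : m = (m %/ q * q)%N by rewrite divnK // pdiv_dvd.
apply: (loc q) => //.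
apply: (IHn (m %/ q)%N).
- by rewrite (leq_trans _ (lmn : (m <= n)%N)) // ltn_Pdiv // prime_gt1.
- by rewrite rpredM // Aint_int.
- by rewrite divn_gt0 ?prime_gt0 // dvdn_leq // pdiv_dvd.
- by rewrite mulrA -rmorphM -PoszM -mE.
Qed.

End TrinomialField.

Lemma squarefreez_prime (m : int) : m != 0 ->
  (forall q : nat, prime q -> ~~ (q%:Z ^+ 2 %| m)%Z) -> squarefreez m.
Proof.
move=> m0 sqf x xm; rewrite qualifE /=.
have [x1|x1] := leqP `|x| 1.
  have : `|x|%N != 0%N.
    by rewrite absz_eq0; apply: contraNneq m0 => x0; move: xm; rewrite x0 expr0n dvd0z.
  by case: x x1 {xm} => [[|[|]]|[|]].
have := sqf _ (pdiv_prime x1); apply: contraNT => _.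
apply: dvdz_trans xm; rewrite dvdzE !abszX /= dvdn_exp2r //; exact: pdiv_dvd.
Qed.

Lemma squarefree_dvdn (m n : nat) : (0 < m)%N ->
  (forall q, prime q -> ~~ (q ^ 2 %| m)%N) ->
  (forall q, prime q -> (q %| m)%N -> (q %| n)%N) -> (m %| n)%N.
Proof.
move=> m0 sqf mn; apply/(dvdn_partP _ m0) => p; rewrite mem_primes => /and3P[p_pr _ pm].
have := sqf p p_pr; rewrite pfactor_dvdn // -ltnNge ltnS => le1.
rewrite p_part (dvdn_trans _ (mn p p_pr pm)) //.
by rewrite -[X in (_ %| X)%N]expn1 dvdn_exp2l.
Qed.

(** * Monogenicity, and recovering [delta] from the field *)

Section Monogenic.
Variables N : nat.
Hypotheses (N_gt1 : (1 < N)%N) (N_odd : odd N).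

Lemma monogenic_maximal (b : nat) theta :
  monogenic (trinomial N b) -> root (map_poly intr (trinomial N b)) theta ->
  ring_of_integers (Qadjoin theta) = Zadjoin theta.
Proof.
by case=> f_mon _ f_irr bas f_theta; apply/(Zbasis_Zadjoin _ f_mon f_irr f_theta)/bas.
Qed.

Lemma monogenic_squarefree (b : nat) : monogenic (trinomial N b) ->
  squarefreez (delta N b).
Proof.
move=> f_mono; have [f_mon _ f_irr _] := f_mono.
have /closed_rootP[theta f_theta] :
    size (map_poly intr (trinomial N b) : {poly algC}) != 1%N.
  rewrite size_map_inj_poly //; last exact: intr_inj.
  by rewrite size_trinomial // gtn_eqF // ltnS ltnW.
apply: squarefreez_prime => [|q q_pr]; last first.
  exact: (maximal_not_sqr_dvd N_gt1 N_odd f_irr f_theta q_pr (monogenic_maximal f_mono f_theta)).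
have := coprime_delta b (ltnW N_gt1); apply: contraTneq => ->.
by rewrite coprimezE /= /coprime gcdn0 gtn_eqF.
Qed.

Lemma squarefree_monogenic (b : nat) :
  irreducible_poly (map_poly intr (trinomial N b) : {poly rat}) ->
  squarefreez (delta N b) -> monogenic (trinomial N b).
Proof.
move=> f_irr d_sqf; have f_mon : trinomial N b \is monic by apply: trinomial_monic.
split=> // [|theta f_theta]; first by rewrite size_trinomial.
apply/(Zbasis_Zadjoin _ f_mon f_irr f_theta).
exact: (squarefree_maximal N_gt1 N_odd f_irr f_theta d_sqf).
Qed.

(** Both orders are the ring of integers of one field, hence equal; a prime with a nilpotent for [b]
    must therefore divide the other [delta]. *)
Lemma same_extension_dvd (b b' : nat) :
  monogenic (trinomial N b) -> monogenic (trinomial N b') ->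
  generate_same_extension (trinomial N b) (trinomial N b') ->
  (`|delta N b| %| `|delta N b'|)%N.
Proof.
move=> m1 m2 [t1 [t2 [r1 r2 E]]].
have sqf := monogenic_squarefree m1.
have [_ _ i1 _] := m1; have [_ _ i2 _] := m2.
have ZE : Zadjoin t1 = Zadjoin t2.
  by rewrite -(monogenic_maximal m1 r1) E (monogenic_maximal m2 r2).
apply: squarefree_dvdn => [|q q_pr|q q_pr qd].
- rewrite lt0n absz_eq0; apply/eqP => d0.
  by have := sqf 0; rewrite d0 dvdz0 => /(_ isT).
- by apply: contraTN q_pr => /(sqf q%:Z); rewrite qualifE /=; case: (q) => [|[|]].
have [//|qd'] := boolP (q %| `|delta N b'|)%N.
have [y [Zy Zy2 []]] := ramified N_gt1 N_odd i1 r1 q_pr qd.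
rewrite ZE in Zy Zy2 *; exact: (unramified N_gt1 N_odd i2 r2 q_pr qd' Zy Zy2).
Qed.

(** The absolute value of [delta] is [N ^ n - 1] with [n = b (N - 1) + N], which is injective in
    [b]. *)
Lemma same_extension_eq (b b' : nat) :
  monogenic (trinomial N b) -> monogenic (trinomial N b') ->
  generate_same_extension (trinomial N b) (trinomial N b') -> b = b'.
Proof.
move=> m1 m2 E.
have E' : generate_same_extension (trinomial N b') (trinomial N b).
  by case: E => t1 [t2 [r1 r2 K]]; exists t2, t1.
have absd c : `|delta N c|%N = (N ^ ((c + 1) * N - c)).-1.
  rewrite deltaE -[LHS]abszN opprB -[N%:Z]natz -natrX natz -predn_int //.
  by rewrite expn_gt0 (ltnW N_gt1).
have /eqP : (`|delta N b| == `|delta N b'|)%N.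
  by rewrite eqn_dvd !same_extension_dvd.
rewrite !absd => /(congr1 S); rewrite !prednK ?expn_gt0 ?(ltnW N_gt1) //.
move/eqP; rewrite eqn_exp2l // => /eqP; nia.
Qed.

End Monogenic.

(** * Valuations of binomial sums *)

(** Both sides count [t! / (r! (j - r)! (t - j)!)]. *)
Lemma mul_bin_bin (t j r : nat) : (r <= j <= t)%N ->
  ('C(t, j) * 'C(j, r) = 'C(t, r) * 'C(t - r, j - r))%N.
Proof.
case/andP=> rj jt; have rt := leq_trans rj jt.
have e4 : ('C(t - r, j - r) * ((j - r)`! * (t - j)`!) = (t - r)`!)%N.
  by have := @bin_fact (t - r) (j - r); rewrite subnBA // subnK // leq_sub2r //; apply.
have p0 : (0 < r`! * ((j - r)`! * (t - j)`!))%N by rewrite !muln_gt0 !fact_gt0.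
apply/eqP; rewrite -(eqn_pmul2r p0); apply/eqP; transitivity t`!.
  by rewrite -(bin_fact jt) -(bin_fact rj); ring.
by rewrite -(bin_fact rt) -e4; ring.
Qed.

Lemma absz_mulrn (x : int) n : `|x *+ n|%N = (`|x| * n)%N.
Proof. by rewrite -mulr_natr natz abszM. Qed.

(* Since 'C(t, j) 'C(j, r) = 'C(t, r) 'C(t - r, j - r), the term of index [r] has
   strictly smaller [q]-adic valuation than all the others. *)
Lemma binomial_sum_neq0 (q r t g : nat) (E : nat -> int) : prime q -> (r <= t)%N ->
  (forall j, (j < r)%N -> E j = 0) -> ~~ ((q ^ g.+1)%N %| E r)%Z ->
  (forall j, (r < j <= t)%N -> ((q ^ (g.+1 + logn q 'C(j, r)))%N %| E j)%Z) ->
  \sum_(j < t.+1) E j *+ 'C(t, j) <> 0.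
Proof.
move=> q_pr rt E0 Er Ej; rewrite (bigD1 (Ordinal (rt : r < t.+1)%N)) //= => /eqP.
rewrite addr_eq0 => /eqP sumE; set u := logn q 'C(t, r).
have Er0 : E r != 0 by apply: contraNneq Er => ->; apply: dvdz0.
have : ((q ^ (u + g.+1))%N %| E r *+ 'C(t, r))%Z.
  rewrite sumE rpredN rpred_sum // => j; rewrite -(inj_eq val_inj) /= => jr.
  have [jltr|] := ltnP j r; first by rewrite E0 // mul0rn.
  rewrite leq_eqVlt eq_sym (negPf jr) /= => rltj.
  have jt : (r < j <= t)%N by rewrite rltj -ltnS ltn_ord.
  have [Ej0|Ej0] := eqVneq (E j) 0; first by rewrite Ej0 mul0rn.
  have jt' : (j <= t)%N by case/andP: jt.
  have := congr1 (logn q) (@mul_bin_bin t j r _); rewrite (ltnW rltj) jt' => /(_ isT).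
  rewrite !lognM ?bin_gt0 ?leq_sub2r ?(ltnW rltj) //.
  have := Ej _ jt; rewrite !dvdzE absz_mulrn /= !pfactor_dvdn ?muln_gt0 ?absz_gt0 ?Ej0 ?bin_gt0 //.
  by rewrite lognM ?absz_gt0 ?bin_gt0 // -/u; lia.
rewrite dvdzE absz_mulrn pfactor_dvdn ?muln_gt0 ?absz_gt0 ?Er0 ?bin_gt0 //.
rewrite lognM ?absz_gt0 ?bin_gt0 // -/u.
by move: Er; rewrite dvdzE /= pfactor_dvdn ?absz_gt0 //; lia.
Qed.

(** Only one factor can be divisible by [q], and [v (q - 1) < q ^ v <= m] for its valuation [v]. *)
Lemma logn_coprime_bound (q a b m : nat) : prime q -> coprime a b ->
  (0 < a <= m)%N -> (0 < b <= m)%N -> (logn q (a * b) * q.-1 < m)%N.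
Proof.
move=> q_pr cab /andP[a0 am] /andP[b0 bm].
have bound c : (0 < c <= m)%N -> (logn q c * q.-1 < m)%N.
  case/andP=> c0 cm; apply: leq_trans cm; apply: leq_trans (dvdn_leq c0 (pfactor_dvdnn q c)).
  have := prime_gt1 q_pr; elim: (logn q c) => // n IHn q1.
  by have := IHn q1; rewrite expnS; nia.
rewrite lognM //; have [qa|qa] := boolP (q %| a)%N.
  have : ~~ (q %| b)%N.
    apply/negP => qb; have : (q %| gcdn a b)%N by rewrite dvdn_gcd qa.
    by rewrite (eqP cab) dvdn1 => /eqP q1; rewrite q1 in q_pr.
  by move=> qb; rewrite (@logn_coprime q b) ?prime_coprime // addn0 bound ?a0.
by rewrite (@logn_coprime q a) ?prime_coprime // bound ?b0.
Qed.

(* [(a + b s) (u + v s) ^ n] has coordinates [qseq D u v a b n] when [s ^ 2 = D] *)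
Fixpoint qseq (D u v a b : int) (n : nat) : int * int :=
  if n is n'.+1 then
    let: (x, y) := qseq D u v a b n' in (u * x + D * v * y, v * x + u * y)
  else (a, b).

Lemma qseqS D u v a b n : qseq D u v a b n.+1 =
  (u * (qseq D u v a b n).1 + D * v * (qseq D u v a b n).2,
   v * (qseq D u v a b n).1 + u * (qseq D u v a b n).2).
Proof. by rewrite /=; case: (qseq D u v a b n). Qed.

(** * Binomial expansions in an imaginary quadratic field *)

Section Quadratic.
Variables (D : int) (s : algC).
Hypotheses (D_lt0 : D < 0) (sD : s ^+ 2 = D%:~R).

Lemma qseqE u v a b n : (a%:~R + b%:~R * s) * (u%:~R + v%:~R * s) ^+ n =
  (qseq D u v a b n).1%:~R + (qseq D u v a b n).2%:~R * s.
Proof.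
elim: n => [|n IHn]; first by rewrite expr0 mulr1.
rewrite exprSr mulrA IHn qseqS /=; move: (qseq _ _ _ _ _ n) => [x y] /=.
rewrite !rmorphD !rmorphM /= -sD; ring.
Qed.

(** Squaring [a - c = (y - x) s] equates a nonnegative number with a nonpositive one. *)
Lemma sqrt_indep (a c : int) (x y : algC) : x \is Num.real -> y \is Num.real ->
  a%:~R + x * s = c%:~R + y * s -> a = c.
Proof.
move=> xR yR E; have /(congr1 (fun z => z ^+ 2)) : (a - c)%:~R = (y - x) * s.
  by rewrite rmorphB /= -[a%:~R](addrK (x * s)) E; ring.
rewrite exprMn sD => E2.
have : ((a - c)%:~R : algC) ^+ 2 <= 0.
  rewrite E2; apply: mulr_ge0_le0; last by rewrite lerz0 ltW.
  by apply: real_exprn_even_ge0 => //; apply: rpredB.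
rewrite -rmorphXn /= lerz0 => H.
have : (a - c) ^+ 2 == 0 by rewrite eq_le H sqr_ge0.
by rewrite expf_eq0 /= subr_eq0 => /eqP.
Qed.

Lemma binomial_re (x u v a b c : int) (y : algC) t : y \is Num.real ->
  (a%:~R + b%:~R * s) * (x%:~R + (u%:~R + v%:~R * s)) ^+ t = c%:~R + y * s ->
  \sum_(j < t.+1) (x ^+ (t - j) * (qseq D u v a b j).1) *+ 'C(t, j) = c.
Proof.
move=> yR E; pose z := \sum_(j < t.+1) (x ^+ (t - j) * (qseq D u v a b j).2) *+ 'C(t, j).
apply: (@sqrt_indep _ _ z%:~R y) => //; first by rewrite realz.
rewrite -E exprDn mulr_sumr /z !rmorph_sum mulr_suml -big_split; apply: eq_bigr => j _ /=.
rewrite mulrnAr mulrCA qseqE -rmorphXn /=.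
move: (qseq _ _ _ _ _ j) (x ^+ _) => [a1 b1] x1 /=.
by rewrite !rmorphMn !rmorphM /= mulrnAl -mulrnDl mulrDr mulrA.
Qed.

Lemma qseq01 n : qseq D 0 1 1 0 n.*2 = (D ^+ n, 0) /\ qseq D 0 1 1 0 n.*2.+1 = (0, D ^+ n).
Proof.
elim: n => [|n [_ IHn]]; first by split=> //=; congr (_, _); ring.
have E : qseq D 0 1 1 0 n.+1.*2 = (D ^+ n.+1, 0).
  by rewrite doubleS qseqS IHn /= exprS; congr (_, _); ring.
by split=> //; rewrite qseqS E /=; congr (_, _); ring.
Qed.

End Quadratic.

Arguments qseq : simpl never.

Section QuadraticPower.
Variables (D : int) (s : algC).
Hypotheses (D_lt0 : D < 0) (sD : s ^+ 2 = D%:~R).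

Lemma pow_sqrt_re (p : nat) (x : int) (y : algC) : y \is Num.real ->
  (x%:~R + s) ^+ p = 1 + y * s ->
  \sum_(j < p.+1) (x ^+ (p - j) * (qseq D 0 1 1 0 j).1) *+ 'C(p, j) = 1.
Proof.
move=> yR E; apply: (binomial_re (y := y) D_lt0 sD) => //.
by rewrite mul0r addr0 mul1r add0r mul1r E.
Qed.

Lemma qseq01_odd n : odd n -> (qseq D 0 1 1 0 n).1 = 0.
Proof.
by move=> n_odd; rewrite -(odd_double_half n) n_odd add1n (qseq01 D _).2.
Qed.

(** Odd powers of [s] have no real part, so every term of the real part contains [x], and [x]
    divides 1. Modulo [p] only [x ^ p] survives, and [x = -1] would make [p] divide 2. *)
Lemma pow_sqrt_re1 (p : nat) (x : int) (y : algC) : prime p -> odd p ->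
  y \is Num.real -> (x%:~R + s) ^+ p = 1 + y * s -> x = 1.
Proof.
move=> p_pr p_odd yR /(pow_sqrt_re yR) sumE.
have p_gt2 : (2 < p)%N by rewrite odd_prime_gt2.
have : (x %| 1%R)%Z.
  rewrite -sumE rpred_sum // => j _; rewrite rpredMn //.
  have [jp|pj] := ltnP j p; first by rewrite dvdz_mulr // dvdz_exp // subn_gt0.
  have -> : j = p :> nat by apply/eqP; rewrite eqn_leq pj -ltnS ltn_ord.
  by rewrite qseq01_odd // mulr0 dvdz0.
rewrite dvdz1 => /eqP absx.
have [//|xN1] : x = 1 \/ x = -1 by move: absx; clear; lia.
have : (p %| (1 - x ^+ p)%R)%Z.
  rewrite -sumE big_ord_recl /= subn0 bin0 mulr1n mulr1 addrAC subrr add0r.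
  apply: rpred_sum => j _; rewrite /bump leq0n add1n.
  have [jp|pj] := ltnP j.+1 p.
    by rewrite -mulr_natr natz dvdz_mull // dvdzE /= prime_dvd_bin.
  have -> : j.+1 = p :> nat by apply/eqP; rewrite eqn_leq pj ltn_ord.
  by rewrite qseq01_odd // mulr0 mul0rn dvdz0.
rewrite xN1 -signr_odd p_odd expr1 opprK dvdzE /= => /dvdn_leq.
by move=> /(_ isT); rewrite leqNgt -[(1 + 1)%N]/2%N p_gt2.
Qed.

Lemma pow_1sqrt_dvd (p q : nat) (y : algC) : prime p -> odd p -> y \is Num.real ->
  (1 + s) ^+ p = 1 + y * s -> prime q -> (q %| D)%Z ->
  q = 2%N \/ q = 3%N /\ ~~ (9 %| D)%Z.
Proof.
move=> p_pr p_odd yR E q_pr qD.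
have p_gt2 : (2 < p)%N by rewrite odd_prime_gt2.
have sumE := pow_sqrt_re (x := 1) yR E.
apply: contrapT => qn.
have D0 : D != 0 by rewrite lt_eqF.
have D0' : (0 < `|D|)%N by rewrite absz_gt0.
set g := logn q `|D|.
have g_gt0 : (0 < g)%N by rewrite -pfactor_dvdn //; rewrite dvdzE in qD.
(* In the remaining cases the term ['C(p, 2) D] has strictly smallest [q]-adic valuation among the
   ['C(p, 2 k) D ^ k], [k >= 1]. *)
have q_gt4 : (4 < q)%N \/ q = 3%N /\ (1 < g)%N.
  case: (ltngtP q 4) => [q4|q4|q4]; [right|by left|by rewrite q4 in q_pr].
  have q3 : q = 3%N.
    by apply: contrapT => q3; apply: qn; left; have := prime_gt1 q_pr; lia.
  split=> //; apply: contrapT => g1; apply: qn; right; split=> //.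
  by rewrite dvdzE -[`|9%Z|%N]/(3 ^ 2)%N pfactor_dvdn // -q3 -/g; apply/negP.
(* The term of index 0 is dropped, as it cancels the 1 on the right-hand side. *)
pose Ej j := if j is 0 then 0 else (qseq D 0 1 1 0 j).1.
apply: (@binomial_sum_neq0 q 2 p g Ej) => //.
- exact: ltnW.
- by case=> [|[|j]] // _; rewrite /Ej qseq01_odd.
- rewrite /Ej (qseq01 D 1).1 /= expr1 dvdzE pfactor_dvdn //= -/g; lia.
- move=> j /andP[j2 _]; rewrite /Ej; case: j j2 => // j j2.
  have [jo|je] := boolP (odd j.+1); first by rewrite qseq01_odd // dvdz0.
  have jE : j.+1 = j.+1./2.*2 by rewrite -[LHS](odd_double_half j.+1) (negPf je).
  move: j.+1./2 jE => k jE; rewrite jE in j2 *; rewrite (qseq01 D k).1 /=.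
  rewrite dvdzE abszX pfactor_dvdn ?expn_gt0 ?D0' // lognX -/g.
  have k2 : (2 <= k)%N by lia.
  have -> : 'C(k.*2, 2) = (k * k.*2.-1)%N by rewrite bin2 -doubleMl doubleK.
  have cop : coprime k k.*2.-1.
    by apply/coprimeP; [lia | exists (2, 1)%N => /=; lia].
  have [k0 k1] : (0 < k <= k.*2.-1)%N /\ (0 < k.*2.-1 <= k.*2.-1)%N by lia.
  have := logn_coprime_bound q_pr cop k0 k1.
  move: (logn q _) => v vk; case: q_gt4 => [q4|[q3 g1]].
    have : (v * 4 <= v * q.-1)%N by rewrite leq_mul2l; apply/orP; right; lia.
    have : (k.-1 * 1 <= k.-1 * g)%N by rewrite leq_mul2l g_gt0 orbT.
    by case: (k) k2 vk => // k'; rewrite mulSn /=; lia.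
  have : (k.-1 * 2 <= k.-1 * g)%N by rewrite leq_mul2l g1 orbT.
  by rewrite q3 in vk; case: (k) k2 vk => // k'; rewrite mulSn /=; lia.
- move: sumE; rewrite !big_ord_recl /= bin0 expr1n mulr1 mul0rn add0r.
  rewrite addrC => /(canRL (addrK _)); rewrite subrr => sumE.
  by rewrite -[RHS]sumE; apply: eq_bigr => j _; rewrite expr1n mul1r.
Qed.

End QuadraticPower.

Lemma qseq_dvdN2 (a b : int) n :
  ((8 ^ n)%N %| (qseq (-2) 16 56 a b n).1)%Z /\ ((8 ^ n)%N %| (qseq (-2) 16 56 a b n).2)%Z.
Proof.
elim: n => [|n [/dvdzP[x xE] /dvdzP[y yE]]]; first by rewrite expn0 !dvd1z.
rewrite qseqS xE yE expnS PoszM /=; split; apply/dvdzP.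
  by exists (2 * x - 14 * y); ring.
by exists (7 * x + 2 * y); ring.
Qed.

(** [16 + 56 s = 8 (2 + 7 s)], and with [s ^ 2 = -2] the factor [2 + 7 s] makes the real part even,
    which gains one more 2. *)
Lemma qseq_dvdN2S (a b : int) n : ((2 ^ (3 * n + 4))%N %| (qseq (-2) 16 56 a b n.+1).1)%Z.
Proof.
have [/dvdzP[x xE] /dvdzP[y yE]] := qseq_dvdN2 a b n.
rewrite qseqS xE yE /= expnD expnM PoszM -[(2 ^ 3)%N]/8%N -[(2 ^ 4)%N]/16%N.
by apply/dvdzP; exists (x - 7 * y); ring.
Qed.

(* [(1 + s) ^ 8 = 1 + (16 + 56 s)] is close to 1 in the 2-adic topology, and the
   derivative of [t |-> Re ((1 + s) ^ (r + 8 t))] has constant valuation 5. *)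
Lemma pow_sqrtN2 (s : algC) (p : nat) (y : algC) : s ^+ 2 = (-2)%:~R -> odd p ->
  y \is Num.real -> (1 + s) ^+ p = 1 + y * s -> p = 1%N \/ p = 5%N.
Proof.
move=> sD p_odd yR E; have D_lt0 : -2 < 0 :> int by [].
pose t := (p %/ 8)%N; pose r := (p %% 8)%N.
have pE : p = (r + t * 8)%N by rewrite addnC -divn_eq.
have s2 : s ^+ 2 = - 2 by rewrite sD.
have E8 : (1 + s) ^+ 8 = 1%:~R + (16%:~R + 56%:~R * s).
  have -> : (1 + s) ^+ 8 = ((((1 + s) ^+ 2) ^+ 2) ^+ 2) by rewrite -!exprM.
  have -> : (1 + s) ^+ 2 = -1 + 2 * s by rewrite sqrrD s2; ring.
  have -> : (-1 + 2 * s) ^+ 2 = -7 - 4 * s by rewrite sqrrD exprMn s2; ring.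
  by rewrite sqrrB exprMn s2; ring.
have key (a b : int) : (1 + s) ^+ r = a%:~R + b%:~R * s ->
    \sum_(j < t.+1) (qseq (-2) 16 56 a b j).1 *+ 'C(t, j) = 1.
  move=> Er; rewrite -[RHS](@binomial_re (-2) s D_lt0 sD 1 16 56 a b 1 y t yR).
    by apply: eq_bigr => j _; rewrite expr1n mul1r.
  by rewrite -Er -E8 -exprM -exprD mulnC -pE E.
(* Modulo 8 only the term [j = 0] survives; this excludes the residues 3 and 7. *)
have mod8 (a b : int) : (1 + s) ^+ r = a%:~R + b%:~R * s -> (8%N %| 1 - a)%Z.
  move/key <-; rewrite big_ord_recl /= bin0 addrAC subrr add0r.
  apply: rpred_sum => j _; rewrite rpredMn //.
  apply: dvdz_trans (qseq_dvdN2 a b _).1.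
  by rewrite dvdzE /= /bump leq0n expnS dvdn_mulr.
(* The term of index 1 is [16 a - 112 b], of valuation at most 5; the later ones are divisible by
   [2 ^ (3 j + 1)]. *)
have val (a b : int) : a = 1 -> (1 + s) ^+ r = a%:~R + b%:~R * s ->
    ~~ (64 %| 16 * a - 112 * b)%Z -> t = 0%N.
  move=> a1 /key sumE nd; case: (posnP t) => // t0; exfalso.
  pose Ej j := if j is 0 then 0 else (qseq (-2) 16 56 a b j).1.
  apply: (@binomial_sum_neq0 2 1 t 5 Ej) => //.
  - by case.
  - apply: contra nd; rewrite /Ej qseqS /= => /dvdzP[x xE]; apply/dvdzP; exists x.
    by rewrite -[64]/((2 ^ 6)%N%:Z) -xE; ring.
  - case=> [|j] // /andP[j1 _]; rewrite /Ej; apply: dvdz_trans (qseq_dvdN2S a b j).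
    rewrite dvdzE /= bin1 dvdn_exp2l //.
    by have := @ltn_logl 2 j.+1 isT; move: (logn 2 _) => v; lia.
  move: sumE; rewrite !big_ord_recl /= bin0 mul0rn add0r mulr1n.
  by rewrite addrC => /(canRL (addrK _)) ->; rewrite a1 subrr.
have : (r < 8)%N by rewrite ltn_mod.
have : odd r by move: p_odd; rewrite pE oddD oddM andbF addbF.
have e2 : (1 + s) ^+ 2 = -1 + 2 * s by rewrite sqrrD s2; ring.
have e3 : (1 + s) ^+ 3 = (-5)%:~R + 1%:~R * s.
  rewrite exprS e2; have -> : (1 + s) * (-1 + 2 * s) = 2 * s ^+ 2 + s - 1 by ring.
  by rewrite s2; ring.
have e5 : (1 + s) ^+ 5 = 1%:~R + (-11)%:~R * s.
  rewrite -[5%N]/(3 + 2)%N exprD e2 e3.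
  have -> : ((-5)%:~R + 1%:~R * s) * (-1 + 2 * s) = 5 + 2 * s ^+ 2 - 11 * s by ring.
  by rewrite s2; ring.
move: mod8 val; rewrite pE.
case: (r) => [|[|[|[|[|[|[|[|]]]]]]]] // mod8 val _ _.
- by left; rewrite (val 1 1) // expr1 !mul1r.
- by have := mod8 _ _ e3.
- by right; rewrite (val 1 (-11)).
have e7 : (1 + s) ^+ 7 = 43%:~R + 13%:~R * s.
  rewrite -[7%N]/(5 + 2)%N exprD e2 e5.
  have -> : (1%:~R + (-11)%:~R * s) * (-1 + 2 * s) = -1 + 13 * s - 22 * s ^+ 2 by ring.
  by rewrite s2; ring.
by have := mod8 _ _ e7.
Qed.

(** [-18 - 3 s = -3 (6 + s)], and [(6 + s) ^ 2 = 6 (5 + 2 s)] supplies the extra factor 3. *)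
Lemma qseq_dvdN6 n : ((3 ^ n.+3)%N %| (qseq (-6) (-18) (-3) 1 1 n.+2).1)%Z /\
  ((3 ^ n.+3)%N %| (qseq (-6) (-18) (-3) 1 1 n.+2).2)%Z.
Proof.
elim: n => [|n [/dvdzP[x xE] /dvdzP[y yE]]]; first by [].
rewrite qseqS xE yE [(3 ^ n.+4)%N]expnS PoszM /=; split; apply/dvdzP.
  by exists (-6 * x + 6 * y); ring.
by exists (- x - 6 * y); ring.
Qed.

Lemma qseq_dvdN6S n : ((3 ^ n.+2.+3)%N %| (qseq (-6) (-18) (-3) 1 1 n.+3).1)%Z.
Proof.
have [/dvdzP[x xE] /dvdzP[y yE]] := qseq_dvdN6 n.
rewrite qseqS xE yE /= -[(n.+2.+3)]/(2 + n.+3)%N expnD PoszM -[(3 ^ 2)%N]/9%N.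
by apply/dvdzP; exists (- 2 * x + 2 * y); ring.
Qed.

(* Here [t |-> Re ((1 + s) ^ (1 + 3 t))] takes the value 1 at [t = 0] and [t = 1],
   and 3-adically nowhere else. *)
Lemma pow_sqrtN6 (s : algC) (t : nat) (y : algC) : s ^+ 2 = (-6)%:~R ->
  y \is Num.real -> (1 + s) ^+ (1 + 3 * t) = 1 + y * s -> (t <= 1)%N.
Proof.
move=> sD yR E; have D_lt0 : -6 < 0 :> int by [].
have s2 : s ^+ 2 = - 6 by rewrite sD.
have E3 : (1 + s) ^+ 3 = 1%:~R + ((-18)%:~R + (-3)%:~R * s).
  have -> : (1 + s) ^+ 3 = 1 + 3 * s + 3 * s ^+ 2 + s * s ^+ 2 by ring.
  by rewrite s2; ring.
have sumE : \sum_(j < t.+1) (qseq (-6) (-18) (-3) 1 1 j).1 *+ 'C(t, j) = 1.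
  rewrite -[RHS](@binomial_re (-6) s D_lt0 sD 1 (-18) (-3) 1 1 1 y t yR).
    by apply: eq_bigr => j _; rewrite expr1n mul1r.
  by rewrite -E3 -exprM mul1r -exprS E.
rewrite leqNgt; apply/negP => t1.
pose Ej j := if j is 0 then 0 else (qseq (-6) (-18) (-3) 1 1 j).1.
(* The term of index 1 vanishes, as [(1 + s) (-18 - 3 s)] has real part [-18 + 18]; that of index 2
   is [-378], of valuation 3. *)
apply: (@binomial_sum_neq0 3 2 t 3 Ej) => //.
- by case=> [|[|]].
- case=> [|[|[|j]]] // _; rewrite /Ej; apply: dvdz_trans (qseq_dvdN6S j).
  rewrite dvdzE /= dvdn_exp2l //.
  have cop : coprime j.+3 j.+2 by apply: coprimeSn.
  have le1 : (0 < j.+3 <= j.+3)%N by rewrite leqnn.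
  have le2 : (0 < j.+2 <= j.+3)%N by rewrite leqnSn.
  have := @logn_coprime_bound 3 j.+3 j.+2 j.+3 isT cop le1 le2.
  have -> : (j.+3 * j.+2 = 2 * 'C(j.+3, 2))%N by have := mul_bin_diag j.+3 1; rewrite bin1.
  rewrite lognM ?bin_gt0 //= -[logn 3 2]/0%N add0n.
  by move: (logn 3 _) => v; lia.
move: sumE; rewrite !big_ord_recl /= bin0 mul0rn add0r mulr1n.
by rewrite addrC => /(canRL (addrK _)) ->; rewrite subrr.
Qed.

(** * Integers of imaginary quadratic fields *)

Lemma ratr_real (y : rat) : (ratr y : algC) \is Num.real.
Proof. by apply: Creal_Crat; apply: Crat_rat. Qed.

(** The 2-adic valuation of [y ^ 2 m] is odd, so that of the integer [E] cannot be 0. *)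
Lemma sqr_rat_mul_even (y : rat) (m E : int) : (2 %| m)%Z -> ~~ (4 %| m)%Z ->
  y ^+ 2 * m%:~R = E%:~R -> (2 %| E)%Z.
Proof.
move=> m2 m4 yE.
have EE : E * denq y ^+ 2 = numq y ^+ 2 * m.
  apply: (@intr_inj rat); rewrite !rmorphM /= -yE -!expr2.
  by rewrite -{1}[y]divq_num_den expr_div_n mulrAC divfK // expf_neq0 // intr_eq0 denq_neq0.
have : coprime `|numq y| `|denq y| by exact: coprime_num_den.
move: (numq y) (denq y) EE m2 => u v EE /dvdzP[k kE] cop.
rewrite kE in EE m4 *.
apply: contraT => E2.
have v2 : (2 %| v)%Z.
  have : (2 %| E * v ^+ 2)%Z by rewrite EE mulrA dvdz_mull.
  rewrite (Gauss_dvdzr _ (_ : coprimez 2 E)); last by rewrite coprimez_prime.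
  by rewrite !dvdzE abszX /= Euclid_dvdX // => /andP[].
have u2 : (2 %| u)%Z.
  apply: contraT => u2.
  case/dvdzP: v2 => w wE; have : (4 %| u ^+ 2 * (k * 2))%Z.
    by rewrite -EE wE exprMn mulrA dvdz_mull.
  rewrite Gauss_dvdzr ?(negPf m4) // coprimezXr // (_ : 4 = 2 ^+ 2) // coprimezXl //.
  by rewrite coprimez_prime.
move: u2 v2; rewrite !dvdzE /= => u2 v2.
have : (2 %| gcdn `|u| `|v|)%N by rewrite dvdn_gcd u2.
by rewrite (eqP cop).
Qed.

Section ImaginaryQuadratic.
Variables (m : int) (theta : algC).
Hypotheses (m_lt0 : m < 0) (m2 : (2 %| m)%Z) (m4 : ~~ (4 %| m)%Z).
Hypothesis theta2 : theta ^+ 2 = m%:~R.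
Local Notation K := (Qadjoin theta).
Local Notation O := (ring_of_integers K).

Lemma conj_sqrt_neg : theta^* = - theta.
Proof.
have : (theta^*) ^+ 2 == theta ^+ 2.
  by rewrite -rmorphXn /= theta2 rmorph_int.
rewrite eqf_sqr => /orP[/eqP th|/eqP //].
have : theta \is Num.real by apply/CrealP.
move/real_exprn_even_ge0 => /(_ 2 isT); rewrite theta2 ler0z.
by rewrite leNgt m_lt0.
Qed.

Lemma conj_Qsqrt (x y : algC) : x \is Num.real -> y \is Num.real ->
  (x + y * theta)^* = x - y * theta.
Proof.
move=> xR yR; rewrite rmorphD rmorphM /= conj_sqrt_neg.
by rewrite !conj_Creal // mulrN.
Qed.

Lemma Qsqrt_horner (p : {poly rat}) :
  exists x y : rat, (map_poly ratr p).[theta] = ratr x + ratr y * theta.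
Proof.
elim/poly_ind: p => [|p c [x [y E]]].
  by exists 0, 0; rewrite rmorph0 horner0 !rmorph0 mul0r addr0.
exists (y * m%:~R + c), x.
rewrite rmorphD rmorphM /= map_polyX map_polyC !hornerE E.
by rewrite rmorphD rmorphM /= ratr_int -theta2; ring.
Qed.

Lemma Qsqrt_in (x y : rat) : K (ratr x + ratr y * theta).
Proof.
exists (x%:P + y *: 'X), 1; rewrite rmorph1 hornerC oner_eq0 divr1; split=> //.
by rewrite rmorphD /= map_polyC map_polyZ map_polyX !hornerE.
Qed.

Lemma KV z : K z -> K z^-1.
Proof.
case=> p [q [q0 ->]]; have [p0|p0] := eqVneq (map_poly ratr p).[theta] 0.
  exists 0, 1; rewrite p0 mul0r invr0 rmorph0 rmorph1 hornerC horner0 oner_eq0 mul0r.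
  by split.
by exists q, p; rewrite p0 invf_div.
Qed.

Lemma KM y z : K y -> K z -> K (y * z).
Proof.
move=> [p [q [q0 ->]]] [p' [q' [q'0 ->]]]; exists (p * p'), (q * q').
by rewrite !rmorphM !hornerM mulf_neq0 // mulf_div.
Qed.

Lemma QsqrtP z : K z -> exists x y : rat, z = ratr x + ratr y * theta.
Proof.
case=> p [q [q0 ->]]; have [a [b aE]] := Qsqrt_horner p.
have [c [e cE]] := Qsqrt_horner q; rewrite aE cE; rewrite {}cE in q0.
pose nrm := c ^+ 2 - e ^+ 2 * m%:~R.
have nE : (ratr c + ratr e * theta) * (ratr c - ratr e * theta) = ratr nrm.
  by rewrite /nrm rmorphB !rmorphM /= ratr_int -theta2; ring.
have nc0 : ratr c - ratr e * theta != 0.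
  by rewrite -conjC_eq0 -mulNr conj_Qsqrt ?rpredN ?ratr_real // mulNr opprK.
have n0 : ratr nrm != 0 :> algC by rewrite -nE mulf_neq0.
exists ((a * c - b * e * m%:~R) / nrm), ((b * c - a * e) / nrm).
apply: (mulIf q0); rewrite divfK // !rmorphM !fmorphV /= !rmorphB !rmorphM /= ratr_int -theta2.
have n0' : ratr c * ratr c - ratr e * ratr e * theta ^+ 2 != 0.
  by rewrite (_ : _ - _ = ratr nrm) // -nE; ring.
by apply: (mulIf n0); rewrite -nE; field; exact: n0'.
Qed.
(** Trace [T = 2 x] and norm [n] are integers, and [(2 y) ^ 2 m = T ^ 2 - 4 n] is even, so [T] is
    even. As [m] may have square factors, [y] stays rational and the integer [E = y ^ 2 m] is
    recorded instead. *)
Lemma O_Qsqrt z : O z -> exists (x : int) (y : rat) (E : int),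
  [/\ z = x%:~R + ratr y * theta, (2 %| E)%Z, E <= 0, y ^+ 2 * m%:~R = E%:~R &
      (ratr y * theta) ^+ 2 = E%:~R].
Proof.
case=> zK zA; have [x [y zE]] := QsqrtP zK.
have czE : z^* = ratr x - ratr y * theta by rewrite zE conj_Qsqrt ?ratr_real.
have czA : z^* \in Aint by rewrite Aint_aut.
have [T TE] : exists T : int, 2 * x = T%:~R.
  have : (ratr (2 * x) : algC) \in Num.int.
    apply: Cint_rat_Aint; first exact: Crat_rat.
    have -> : ratr (2 * x) = z + z^*.
      by rewrite czE zE rmorphM rmorph_nat; ring.
    by rewrite rpredD.
  move/intrP => [T TE]; exists T.
  by apply: (fmorph_inj (ratr : {rmorphism rat -> algC})); rewrite /= ratr_int.
have [n nE] : exists n : int, x ^+ 2 - y ^+ 2 * m%:~R = n%:~R.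
  have : (ratr (x ^+ 2 - y ^+ 2 * m%:~R) : algC) \in Num.int.
    apply: Cint_rat_Aint; first exact: Crat_rat.
    have -> : ratr (x ^+ 2 - y ^+ 2 * m%:~R) = z * z^*.
      by rewrite czE zE rmorphB !rmorphM /= ratr_int -theta2; ring.
    by rewrite rpredM.
  move/intrP => [T' TE']; exists T'.
  by apply: (fmorph_inj (ratr : {rmorphism rat -> algC})); rewrite /= ratr_int.
have W : (2 * y) ^+ 2 * m%:~R = (T ^+ 2 - 4 * n)%:~R.
  by rewrite rmorphB rmorphXn rmorphM /= -TE -nE; ring.
have := sqr_rat_mul_even m2 m4 W.
have [[t tE]|To] : (exists t, T = 2 * t) \/ (exists t, T = 2 * t + 1).
  have nz2 : 2 != 0 :> int by [].
  have := divz_eq T 2; have := modz_ge0 T nz2; have := ltz_mod T nz2.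
  by move: (T %/ 2)%Z (T %% 2)%Z => u v ? ? ->; case: (eqVneq v 0) => ?; [left|right]; exists u; lia.
  have xt : x = t%:~R.
    by apply: (@mulfI _ (2 : rat)) => //; rewrite TE tE rmorphM.
  move=> _; have yE : y ^+ 2 * m%:~R = (t ^+ 2 - n)%:~R.
    by rewrite rmorphB /= -nE rmorphXn /= xt; ring.
  have yE' : (ratr y * theta) ^+ 2 = (t ^+ 2 - n)%:~R.
    by rewrite exprMn theta2 -[in RHS]ratr_int -yE rmorphM rmorphXn /= ratr_int.
  exists t, y, (t ^+ 2 - n); split=> //; first by rewrite zE xt ratr_int.
    exact: sqr_rat_mul_even m2 m4 yE.
  rewrite -(ler_int rat) -yE mulr_ge0_le0 ?sqr_ge0 //.
  by rewrite lerz0 ltW.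
case: To => t -> /dvdzP[k kE]; exfalso.
have : (2 * t + 1) ^+ 2 = 2 * (2 * t ^+ 2 + 2 * t) + 1 :> int by ring.
by lia.
Qed.

Lemma O_Qsqrt_conj x y : x \is Num.real ->
  (x + ratr y * theta) * (x + ratr y * theta)^* = x ^+ 2 - (ratr y * theta) ^+ 2.
Proof. by move=> xR; rewrite conj_Qsqrt ?ratr_real //; ring. Qed.

(** The norm [a ^ 2 - D] must be 1; since [D] is even and nonpositive, [D = 0]. *)
Lemma O_units x y : O x -> O y -> x * y = 1 -> x = 1 \/ x = -1.
Proof.
move=> Ox Oy xy.
have [a [r [D [xE D2 D0 rE rE']]]] := O_Qsqrt Ox.
have [a' [r' [D' [yE _ D0' _ rE'2]]]] := O_Qsqrt Oy.
have : (a ^+ 2 - D) * (a' ^+ 2 - D') = 1.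
  apply: (@intr_inj algC); rewrite rmorphM !rmorphB !rmorphXn /= -rE' -rE'2.
  rewrite -!O_Qsqrt_conj ?realz // -xE -yE mulrACA xy -rmorphM xy rmorph1.
  by rewrite mulr1.
have := sqr_ge0 a; have := sqr_ge0 a'.
move=> a'0 a0 nn.
have n1 : a ^+ 2 - D = 1.
  have : 0 <= a ^+ 2 - D by lia.
  by move: nn; rewrite mulrC => /intUnitRing.unitzPl /orP[/eqP //|/eqP ->].
have D00 : D = 0 by case/dvdzP: D2 => k kE; lia.
have r0 : r = 0.
  apply/eqP; move/eqP: rE; rewrite D00 mulf_eq0 expf_eq0 /= => /orP[//|].
  by rewrite intr_eq0 lt_eqF.
have a1 : a ^+ 2 = 1 by lia.
move/eqP: a1; rewrite sqrf_eq1 xE r0 rmorph0 mul0r addr0.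
by case/orP => /eqP ->; [left|right].
Qed.

End ImaginaryQuadratic.

(** * When [1 + theta] is a [p]-th power of an integer *)

Lemma expn_3mod4 (N n : nat) : (N = 3 %[mod 4])%N -> odd n -> (N ^ n = 3 %[mod 4])%N.
Proof.
move=> N3 n_odd; rewrite -modnXm N3 -(odd_double_half n) n_odd -mul2n.
by rewrite expnD expnM -modnMmr -modnXm modnMmr -modnMmr exp1n.
Qed.

Lemma expn_3mod4_dvd (N n : nat) : (N = 3 %[mod 4])%N -> odd n ->
  (2 %| 1 - N%:Z ^+ n)%Z /\ ~~ (4 %| 1 - N%:Z ^+ n)%Z.
Proof.
move=> N3 n_odd; have E := expn_3mod4 N3 n_odd.
have NE : N%:Z ^+ n = (N ^ n)%N by rewrite -[N%:Z]natz -natrX natz.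
rewrite NE; move: (N ^ n)%N E => k kE; split; first by apply/dvdzP; exists (- ((k %/ 2)%N)%:Z); lia.
by apply/negP => /dvdzP[u uE]; lia.
Qed.

Lemma two_or_six (D : int) : (2 %| D)%Z -> ~~ (4 %| D)%Z ->
  (forall q, prime q -> (q %| D)%Z -> q = 2%N \/ q = 3%N /\ ~~ (9 %| D)%Z) ->
  (`|D| = 2 \/ `|D| = 6)%N.
Proof.
rewrite !dvdzE /= => /dvdnP[r rE] D4 Dq.
have r0 : (0 < r)%N by case: (r) rE D4 => // ->.
have r2 : ~~ (2 %| r)%N by apply: contra D4 => r2; rewrite rE (@dvdn_pmul2r 2 2 r).
have rq q : prime q -> (q %| r)%N -> q = 3%N /\ ~~ (9 %| D)%Z.
  move=> q_pr qr; have qD : (q %| D)%Z by rewrite dvdzE /= rE dvdn_mulr.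
  have [q2|//] := Dq q q_pr qD.
  by rewrite q2 (negPf r2) in qr.
have [r1|r1] := leqP r 1; first by left; lia.
have [q3 D9] := rq _ (pdiv_prime r1) (pdiv_dvd r).
have /dvdnP[r' r'E] : (3 %| r)%N by rewrite -q3 pdiv_dvd.
have [r'1|r'1] := leqP r' 1; first by right; lia.
have r'r : (pdiv r' %| r)%N by rewrite r'E dvdn_mulr // pdiv_dvd.
have [q3' _] := rq _ (pdiv_prime r'1) r'r.
have /dvdnP[w wE] : (3 %| r')%N by rewrite -q3' pdiv_dvd.
by case/negP: D9; rewrite dvdzE /= rE r'E wE -!mulnA dvdn_mull.
Qed.

(* Here [g = 1 + s]; taking norms shows that [1 - s ^ 2] is a power of [N], and real
   parts then leave only [s ^ 2 = -2] and [s ^ 2 = -6]. *)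
Lemma prime_power_1sqrt (N n p : nat) (theta g : algC) :
  (3 <= N)%N -> (N = 3 %[mod 4])%N -> odd n ->
  theta ^+ 2 = (1 - N%:Z ^+ n)%:~R ->
  prime p -> (p %| n)%N -> ring_of_integers (Qadjoin theta) g ->
  g ^+ p = 1 + theta ->
  (N = 3 /\ n = 5)%N \/ N = 7%N /\ forall t, n = (1 + 3 * t)%N -> (t <= 1)%N.
Proof.
move=> N3 Nmod n_odd; set m := 1 - _ => theta2 p_pr /dvdnP[l nE] Og gp.
have [m2 m4] := expn_3mod4_dvd Nmod n_odd; rewrite -/m in m2 m4.
have NE k : N%:Z ^+ k = (N ^ k)%N by rewrite -[N%:Z]natz -natrX natz.
have n_gt0 : (0 < n)%N by case: (n) n_odd.
have [p_odd l_odd] : odd p /\ odd l by move: n_odd; rewrite nE oddM => /andP[].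
have m_lt0 : m < 0.
  by rewrite /m NE subr_lt0 ltz_nat -(expn0 N) ltn_exp2l // ltnW.
have [x [y [D [gE D2 D0 yE sD]]]] := O_Qsqrt m_lt0 m2 m4 theta2 Og.
set s := ratr y * theta in gE sD.
have y0 : y != 0.
  apply: contraTneq m_lt0 => y0; rewrite -leNgt -(ler0z algC) -theta2.
  have -> : theta = (x ^+ p - 1)%:~R.
    apply/eqP; rewrite rmorphB rmorphXn /= eq_sym subr_eq addrC -gp gE /s y0.
    by rewrite rmorph0 mul0r addr0.
  by rewrite -rmorphXn ler0z sqr_ge0.
have D_lt0 : D < 0.
  rewrite lt_neqAle D0 andbT -(intr_eq0 rat) -yE mulf_neq0 ?expf_neq0 //.
  by rewrite intr_eq0 lt_eqF.
have yR : ratr y^-1 \is @Num.real algC by apply: ratr_real.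
have sE : 1 + theta = 1 + ratr y^-1 * s.
  by rewrite /s mulrA -rmorphM mulVf // rmorph1 mul1r.
rewrite gE sE in gp.
have x1 := pow_sqrt_re1 D_lt0 sD p_pr p_odd yR gp; rewrite x1 in gp.
(* Taking norms with [n = l p] gives [1 - D = N ^ l], so [D] is 2 modulo 4. *)
have normE : (1 - D) ^+ p = N%:Z ^+ n.
  apply: (@intr_inj algC); rewrite rmorphXn rmorphB rmorph1 /= -sD.
  have c1 : (1 + s) * (1 + s)^* = 1 - s ^+ 2.
    by rewrite (O_Qsqrt_conj m_lt0 theta2) ?expr1n ?rpred1.
  have := congr1 (fun z => z * z^*) gp; rewrite rmorphXn -exprMn c1 => ->.
  rewrite -sE -[theta]mul1r -[X in X * theta](rmorph1 ratr).
  rewrite (O_Qsqrt_conj m_lt0 theta2) ?rpred1 // rmorph1 mul1r theta2 expr1n.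
  by rewrite -(rmorph1 intr) -rmorphB /= /m opprB addrC subrK.
have DE : D = 1 - N%:Z ^+ l.
  have : (`|1 - D| ^ p == (N ^ l) ^ p)%N.
    by rewrite -abszX normE NE -expnM -nE.
  rewrite eqn_exp2r ?prime_gt0 // => /eqP; rewrite NE; move: D_lt0; clear; lia.
have [_ D4] := expn_3mod4_dvd Nmod l_odd; rewrite -DE in D4.
have l_gt0 : (0 < l)%N by case: (l) l_odd.
(* [N ^ l] is 3 or 7, so [l = 1] and [n = p]. *)
have [D_E|D_E] := two_or_six D2 D4 (fun q => @pow_1sqrt_dvd D s D_lt0 sD p q _ p_pr p_odd yR gp).
  left; have D2' : D = -2 by lia.
  have Nl : (N ^ l = 3)%N by move: DE; rewrite D2' NE; lia.
  have l1 : l = 1%N.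
    apply/eqP; rewrite eqn_leq l_gt0 andbT leqNgt; apply/negP => l2.
    have := leq_pexp2l (ltnW (ltnW N3)) l2; rewrite Nl; nia.
  rewrite l1 expn1 in Nl; rewrite nE l1 mul1n; split=> //.
  rewrite D2' in sD; case: (pow_sqrtN2 sD p_odd yR gp) => // p1.
  by rewrite p1 in p_pr.
right; have D6 : D = -6 by lia.
have Nl : (N ^ l = 7)%N by move: DE; rewrite D6 NE; lia.
have l1 : l = 1%N.
  apply/eqP; rewrite eqn_leq l_gt0 andbT leqNgt; apply/negP => l2.
  have := leq_pexp2l (ltnW (ltnW N3)) l2; rewrite Nl; nia.
rewrite l1 expn1 in Nl; split=> // t tE.
rewrite D6 in sD; rewrite -[p]mul1n -l1 -nE tE in gp.
exact: pow_sqrtN6 sD yR gp.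
Qed.

(** * The ideals (N^k, 1 + sqrt delta) *)

Section ClassGroup.
Local Open Scope classical_set_scope.
Variables (N n : nat) (theta : algC).
Hypotheses (N_gt2 : (3 <= N)%N) (N_mod4 : (N = 3 %[mod 4])%N) (n_odd : odd n).
Hypothesis theta2 : theta ^+ 2 = (1 - N%:Z ^+ n)%:~R.
Local Notation K := (Qadjoin theta).
Local Notation O := (ring_of_integers K).
Local Notation alpha := (1 + theta).

Let m2 := (expn_3mod4_dvd N_mod4 n_odd).1.
Let m4 := (expn_3mod4_dvd N_mod4 n_odd).2.

Let n_gt0 : (0 < n)%N. Proof. by case: (n) n_odd. Qed.

Let m_lt0 : 1 - N%:Z ^+ n < 0.
Proof.
rewrite -[N%:Z]natz -natrX natz subr_lt0 ltz_nat.
by rewrite -[X in (X < _)%N](expn0 N) ltn_exp2l // ltnW.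
Qed.

Let KD x y : K x -> K y -> K (x + y).
Proof.
move=> /(QsqrtP m_lt0 theta2)[a [b ->]] /(QsqrtP m_lt0 theta2)[c [d ->]].
have -> : ratr a + ratr b * theta + (ratr c + ratr d * theta) =
    ratr (a + c) + ratr (b + d) * theta by rewrite !rmorphD /=; ring.
exact: Qsqrt_in.
Qed.

Let K_int (a : int) : K a%:~R.
Proof. by have := Qsqrt_in theta a%:~R 0; rewrite rmorph0 mul0r addr0 ratr_int. Qed.

Let OD x y : O x -> O y -> O (x + y).
Proof. by move=> [xK xA] [yK yA]; split; [apply: KD | apply: rpredD]. Qed.

Let OM x y : O x -> O y -> O (x * y).
Proof. by move=> [xK xA] [yK yA]; split; [apply: KM | apply: rpredM]. Qed.

Let O_int (a : int) : O a%:~R.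
Proof. by split; [apply: K_int | apply: Aint_int]. Qed.

Let ON x : O x -> O (- x).
Proof. by move=> Ox; rewrite -mulN1r; apply: OM => //; apply: (O_int (-1)). Qed.

Let O_nat a : O (a%:R).
Proof. exact: (O_int a). Qed.

Let O0 : O 0. Proof. exact: (O_nat 0). Qed.
Let O1 : O 1. Proof. exact: (O_nat 1). Qed.

Let O_exp x k : O x -> O (x ^+ k).
Proof. by move=> Ox; elim: k => [|k IHk]; rewrite ?expr0 // exprS; apply: OM. Qed.

Let O_theta : O theta.
Proof.
split; first by have := Qsqrt_in theta 0 1; rewrite rmorph0 rmorph1 add0r mul1r.
by apply: Aint_sqr; rewrite theta2 Aint_int.
Qed.

Let O_alpha : O alpha. Proof. by apply: OD. Qed.

Let alpha_neq0 : alpha != 0.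
Proof.
apply: contraTneq m_lt0 => /eqP; rewrite addrC addr_eq0 => /eqP tE.
by move: theta2; rewrite tE -leNgt -(ler0z algC) => <-; rewrite sqrrN expr1n ler01.
Qed.

Let alpha_norm : alpha * (1 - theta) = N%:R ^+ n.
Proof.
have -> : alpha * (1 - theta) = 1 - theta ^+ 2 by ring.
by rewrite theta2 rmorphB rmorphXn rmorph1 opprB addrC subrK.
Qed.

Definition pideal (k : nat) : set algC :=
  [set z | exists a b, [/\ O a, O b & z = a * N%:R ^+ k + b * alpha]].

Let pideal_sub k z : pideal k z -> O z.
Proof. by case=> a [b [Oa Ob ->]]; apply: OD; apply: OM => //; apply: O_exp. Qed.

Let pidealD k x y : pideal k x -> pideal k y -> pideal k (x + y).
Proof.
move=> [a [b [Oa Ob ->]]] [c [d [Oc Od ->]]]; exists (a + c), (b + d).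
by split; [exact: OD | exact: OD | ring].
Qed.

Let pidealM k a x : O a -> pideal k x -> pideal k (a * x).
Proof.
move=> Oa [c [d [Oc Od ->]]]; exists (a * c), (a * d).
by split; [exact: OM | exact: OM | ring].
Qed.

Let pideal_sum k j (F : 'I_j -> algC) : (forall i, pideal k (F i)) -> pideal k (\sum_i F i).
Proof.
move=> HF; apply: big_ind => //; last exact: pidealD.
by exists 0, 0; split=> //; rewrite !mul0r addr0.
Qed.

Let pideal_N k : pideal k (N%:R ^+ k).
Proof. by exists 1, 0; split=> //; rewrite mul1r mul0r addr0. Qed.

Let pideal_alpha k : pideal k alpha.
Proof. by exists 0, 1; split=> //; rewrite mul1r mul0r add0r. Qed.

(* The product contains [alpha ^ 2 = 2 alpha - N ^ n], hence [2 alpha], and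
   [N ^ i alpha] with [N] odd, hence [alpha]. *)
Lemma pidealX i j : (i + j <= n)%N -> idealM (pideal i) (pideal j) = pideal (i + j).
Proof.
move=> ijn; apply/seteqP; split=> [z [k [u [v [Hu Hv ->]]]]|z [a [b [Oa Ob ->]]]].
  apply: pideal_sum => l; have [a [b [Oa Ob ->]]] := Hu l; have [c [d [Oc Od ->]]] := Hv l.
  exists (a * c), (a * N%:R ^+ i * d + b * (c * N%:R ^+ j + d * alpha)); split.
  - exact: OM.
  - by apply: OD; apply: OM => //; [apply: OM => //; apply: O_exp |
      apply: OD; apply: OM => //; apply: O_exp].
  - by rewrite exprD; ring.
have cop : coprimez 2 (N%:Z ^+ i).
  rewrite coprimezXr // coprimez_prime // dvdzE /= dvdn2.
  by move: N_mod4; clear; lia.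
have [[u v] /= uv] := coprimezP _ _ cop.
(* With [2 u + v N ^ i = 1], [b alpha = b u (alpha ^ 2 + N ^ n) + b v N ^ i alpha]; the part in
   [N ^ n] joins the first product. *)
pose U i0 : algC := if i0 == 0 :> nat then
  (a + b * u%:~R * N%:R ^+ (n - (i + j))) * N%:R ^+ i else b * u%:~R * alpha + b * v%:~R * N%:R ^+ i.
pose V i0 : algC := if i0 == 0 :> nat then N%:R ^+ j else alpha.
exists 2%N, U, V; split.
- move=> i0; rewrite /U; case: ifP => _.
    by apply: pidealM => //; apply: OD => //; apply: OM; [apply: OM | apply: O_exp].
  by apply: pidealD; apply: pidealM => //; apply: OM.
- by move=> i0; rewrite /V; case: ifP.
have Nn : N%:R ^+ n = N%:R ^+ (n - (i + j)) * N%:R ^+ i * N%:R ^+ j :> algC.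
  by rewrite -!exprD -addnA subnK.
have a2 : alpha ^+ 2 = 2 * alpha - N%:R ^+ n by rewrite -alpha_norm; ring.
have uv' : u%:~R * 2 + v%:~R * N%:R ^+ i = 1 :> algC.
  by rewrite -[RHS](rmorph1 intr) -uv rmorphD !rmorphM rmorphXn.
rewrite !big_ord_recl big_ord0 addr0 /U /V /= exprD.
transitivity (a * (N%:R ^+ i * N%:R ^+ j) + b * ((u%:~R * 2 + v%:~R * N%:R ^+ i) * alpha)).
  by rewrite uv' mul1r.
have -> : (b * u%:~R * alpha + b * v%:~R * N%:R ^+ i) * alpha =
  b * (u%:~R * alpha ^+ 2 + v%:~R * N%:R ^+ i * alpha) by ring.
by rewrite a2 Nn; ring.
Qed.

Lemma pideal0 : pideal 0 = O.
Proof.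
apply/seteqP; split=> z; first exact: pideal_sub.
by move=> Oz; exists z, 0; split=> //; rewrite expr0 mulr1 mul0r addr0.
Qed.

Lemma pideal_n : pideal n = [set alpha * x | x in O].
Proof.
apply/seteqP; split=> [z [a [b [Oa Ob ->]]]|_ [x Ox <-]].
  exists (a * (1 - theta) + b); last by rewrite -alpha_norm; ring.
  by apply: OD => //; apply: OM => //; apply: OD => //; apply: ON.
by exists 0, x; split=> //; rewrite mul0r add0r mulrC.
Qed.

Lemma pideal_fractional : fractional_ideal K (pideal 1).
Proof.
split.
- by move=> z /pideal_sub [].
- by move=> x y Ix Iy; apply: pidealD => //; rewrite -mulN1r; apply: pidealM => //; apply: (O_int (-1)).
- exact: pidealM.
- by exists alpha.
by exists 1; split; [exact: O1 | exact: oner_neq0 | move=> x Ix; rewrite mul1r; apply: pideal_sub Ix].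
Qed.

Lemma class_groupX_pideal k : (k <= n)%N ->
  class_groupX K (ideal_class K (pideal 1)) k = ideal_class K (pideal k).
Proof.
elim: k => [_|k IHk kn]; first by rewrite pideal0.
by rewrite /class_groupX iterS -/(class_groupX _ _ _) IHk ?(ltnW kn) // ideal_classM pidealX.
Qed.

Let principal k := exists beta, [/\ K beta, beta != 0 & pideal k = [set beta * x | x in O]].

Lemma ideal_class1P k : ideal_class K (pideal k) = class_group1 K <-> principal k.
Proof.
split=> [E|[beta [Kb b0 E]]].
  have : ideal_class K (pideal k) (pideal k).
    exists 1; split; [exact: (K_int 1) | exact: oner_neq0 |].
    by apply/seteqP; split=> [x Ix|_ [x Ix <-]]; [exists x; rewrite ?mul1r | rewrite mul1r].
  by rewrite E => -[a [Ka a0 aE]]; exists a.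
have scale (c d : algC) (A : set algC) : [set c * x | x in [set d * x | x in A]] = [set (c * d) * x | x in A].
  apply/seteqP; split=> [_ [_ [x Ax <-] <-]|_ [x Ax <-]]; first by exists x; rewrite ?mulrA.
  by exists (d * x); [exists x | rewrite mulrA].
apply/seteqP; split=> [_ [a [Ka a0 ->]]|_ [a [Ka a0 ->]]].
  by exists (a * beta); split; [exact: KM | rewrite mulf_neq0 | rewrite E scale].
exists (a / beta); split; [by apply: KM => //; apply: KV | by rewrite mulf_neq0 ?invr_eq0 |].
by rewrite E scale divfK.
Qed.

Lemma pideal_principalD k j beta : (k + j <= n)%N -> pideal k = [set beta * x | x in O] ->
  pideal (k + j) = [set beta * x | x in pideal j].
Proof.
move=> kjn E; rewrite -pidealX // E; apply/seteqP; split=> [z [l [u [v [Hu Hv ->]]]]|_ [x Ix <-]].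
  have /choice[w wP] i : exists x, O x /\ beta * x = u i.
    by have [x Ox <-] := Hu i; exists x.
  exists (\sum_i w i * v i).
    by apply: pideal_sum => i; apply: pidealM => //; case: (wP i).
  by rewrite mulr_sumr; apply: eq_bigr => i _; case: (wP i) => _ <-; rewrite mulrA.
exists 1%N, (fun=> beta), (fun=> x); split=> // [_|]; last by rewrite big_ord1.
by exists 1; rewrite ?mulr1.
Qed.

Lemma pideal_principalX k j q beta : (k * q + j <= n)%N -> pideal k = [set beta * x | x in O] ->
  pideal (k * q + j) = [set beta ^+ q * x | x in pideal j].
Proof.
elim: q => [|q IHq] kn E.
  rewrite muln0 add0n expr0; apply/seteqP.
  by split=> [x Ix|_ [x Ix <-]]; [exists x; rewrite ?mul1r | rewrite mul1r].
rewrite mulnS -addnA in kn *; rewrite (pideal_principalD kn E) IHq //; last first.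
  by apply: leq_trans kn; rewrite leq_addl.
apply/seteqP; split=> [_ [_ [x Ix <-] <-]|_ [x Ix <-]].
  by exists x; rewrite // exprS mulrA.
by exists (beta ^+ q * x); [exists x | rewrite exprS mulrA].
Qed.

(** Euclidean descent: with [n = k q + r], [(alpha)] is [beta ^ q] times [pideal r], so a nonzero
    [r] is a smaller principal exponent. If [r = 0], [alpha] is [beta ^ q] up to a unit, and [p] is
    a prime factor of [q]. *)
Lemma principal_exponent k : (0 < k < n)%N -> principal k ->
  exists p g, [/\ prime p, (p %| n)%N, O g & g ^+ p = alpha].
Proof.
elim: k {-2}k (leqnn k) => [|k0 IHk] k kk0 /andP[k_gt0 kn] prk.
  by move: kk0 k_gt0; rewrite leqn0 => /eqP ->.
have [beta [Kb b0 E]] := prk.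
have nE := divn_eq n k; rewrite mulnC in nE; set q := (n %/ k)%N in nE.
have kq : (k * q + n %% k <= n)%N by rewrite -nE.
have := pideal_principalX kq E; rewrite -nE pideal_n => E'.
have bq0 : beta ^+ q != 0 by rewrite expf_neq0.
have [r0|r0] := posnP (n %% k); last first.
  have rk : (n %% k < k)%N by rewrite ltn_mod.
  apply: (IHk (n %% k)%N); first by rewrite -ltnS (leq_trans rk).
    by rewrite r0 (ltn_trans rk).
  exists (alpha / beta ^+ q); split; last 1 first.
  - apply/seteqP; split=> [x Ix|_ [x Ox <-]].
      have : [set alpha * x | x in O] (beta ^+ q * x) by rewrite E'; exists x.
      by case=> y Oy yE; exists y; rewrite // mulrAC yE mulrC mulKf.
    have : [set beta ^+ q * x | x in pideal (n %% k)] (alpha * x) by rewrite -E'; exists x.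
    by case=> y Iy yE; rewrite mulrAC -yE mulrC mulKf.
  - apply: KM; first by case: O_alpha.
    apply: KV; elim: (q) => [|i IHi]; first exact: (K_int 1).
    by rewrite exprS; apply: KM.
  by rewrite mulf_neq0 ?invr_eq0.
rewrite r0 pideal0 in E'; rewrite r0 addn0 in nE.
have Ob : O beta.
  by apply: (@pideal_sub k); rewrite E; exists 1; rewrite ?mulr1.
have [x Ox xE] : [set beta ^+ q * x | x in O] alpha by rewrite -E'; exists 1; rewrite ?mulr1.
have [y Oy yE] : [set alpha * x | x in O] (beta ^+ q).
  by rewrite E'; exists 1; rewrite ?mulr1.
have xy : x * y = 1 by apply: (mulfI bq0); rewrite mulrA xE yE mulr1.
have q_gt1 : (1 < q)%N.
  by rewrite ltnNge; apply/negP => q1; move: kn; rewrite nE; nia.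
have q_pr := pdiv_prime q_gt1; set p := pdiv q in q_pr.
have pq : (p %| q)%N by apply: pdiv_dvd.
have pn : (p %| n)%N by rewrite nE dvdn_mull.
have p_odd : odd p by move/dvdnP: pn n_odd => [l ->]; rewrite oddM => /andP[].
have gE : (beta ^+ (q %/ p)) ^+ p = beta ^+ q by rewrite -exprM divnK.
(* The unit is a sign, absorbed into the base because [p] is odd. *)
have := O_units m_lt0 m2 m4 theta2 Ox Oy xy; case=> x1; rewrite x1 in xE.
  by exists p, (beta ^+ (q %/ p)); rewrite gE -xE mulr1; split=> //; apply: O_exp.
exists p, (- beta ^+ (q %/ p)); rewrite exprNn -signr_odd p_odd expr1 gE -xE mulrN1 mulN1r.
by split=> //; apply: ON; apply: O_exp.
Qed.

Lemma class_group_order_pideal :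
  ~ (N = 3 /\ n = 5)%N -> ~ (N = 7%N /\ forall t, n = (1 + 3 * t)%N -> (t <= 1)%N) ->
  class_group_order K (ideal_class K (pideal 1)) n.
Proof.
move=> N3 N7; split=> // [|k /andP[k0 kn]]; rewrite class_groupX_pideal ?(ltnW kn) //.
  apply/ideal_class1P; exists alpha; split=> //; last exact: pideal_n.
  by case: O_alpha.
move/ideal_class1P/(principal_exponent (introT andP (conj k0 kn))) => [p [g [p_pr pn Og gp]]].
by have [] := prime_power_1sqrt N_gt2 N_mod4 n_odd theta2 p_pr pn Og gp.
Qed.

End ClassGroup.

(** * The exceptional pair [N = 3], [b = 1], and the three claims together *)

Lemma reducible_trinomial_3_1 :
  ~ irreducible_poly (map_poly intr (trinomial 3 1) : {poly rat}).
Proof.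
case=> _ irr; have /irr : size ('X - 2%:P : {poly rat}) != 1%N by rewrite size_XsubC.
have -> : 'X - 2%:P %| (map_poly intr (trinomial 3 1) : {poly rat}).
  rewrite dvdp_XsubCl /root /trinomial !rmorphB /= map_polyXn map_polyX map_polyC /=.
  by rewrite !hornerE.
move=> /(_ isT) /eqp_size; rewrite size_XsubC size_map_inj_poly //; last exact: intr_inj.
by rewrite size_trinomial.
Qed.

Theorem theorem1p8 (N b : nat) (hb : (1 <= b)%N) (hN : (3 <= N)%N)
  (hmod : N = 3 %[mod 4])
  (hirr : irreducible_poly (map_poly intr (trinomial N b) : {poly rat})) :
  [/\ monogenic (trinomial N b) <-> squarefreez (delta N b),
      (forall b' : nat, (1 <= b')%N ->
         monogenic (trinomial N b) -> monogenic (trinomial N b') ->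
         trinomial N b <> trinomial N b' ->
         ~ generate_same_extension (trinomial N b) (trinomial N b')) &
      exists2 C : set (set algC),
        class_group (Qadjoin (sqrtC (delta N b)%:~R)) C &
        class_group_order (Qadjoin (sqrtC (delta N b)%:~R)) C
          ((b + 1) * N - b)%N].
Proof.
have N_gt1 : (1 < N)%N by apply: ltnW.
have N_odd : odd N by move: hmod; clear; lia.
split.
- by split; [exact: monogenic_squarefree | exact: squarefree_monogenic].
- by move=> b' _ m1 m2 neq /(same_extension_eq N_gt1 N_odd m1 m2) bE; apply: neq; rewrite bE.
set n := ((b + 1) * N - b)%N.
have n_odd : odd n.
  rewrite /n oddB ?oddM ?oddD ?N_odd //=; last by move: hN; clear; nia.
  by case: (odd b).
have theta2 : (sqrtC (delta N b)%:~R : algC) ^+ 2 = (1 - N%:Z ^+ n)%:~R.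
  by rewrite sqrtCK deltaE.
exists (ideal_class (Qadjoin (sqrtC (delta N b)%:~R)) (pideal N (sqrtC (delta N b)%:~R) 1)).
  by exists (pideal N (sqrtC (delta N b)%:~R) 1) => //; exact: (pideal_fractional hN n_odd theta2).
have N3 : ~ (N = 3 /\ n = 5)%N.
  case=> N3 n5; apply: reducible_trinomial_3_1.
  have b1 : b = 1%N by move: n5; rewrite /n N3; clear; lia.
  by rewrite -N3 -b1.
have N7 : ~ (N = 7%N /\ forall t, n = (1 + 3 * t)%N -> (t <= 1)%N).
  (* For [N = 7], [n = 6 b + 7 = 1 + 3 (2 b + 2)]. *)
  case=> N7 /(_ (2 * b + 2)%N) H; have : (2 * b + 2 <= 1)%N; last by clear; lia.
  by apply: H; rewrite /n N7; clear; lia.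
exact: (class_group_order_pideal hN hmod n_odd theta2 N3 N7).
Qed.
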